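(* Let $f(w)=\sum_{n=0}^{\infty}a_nw^n$ be an entire function of order $\rho$ with $0\le\rho<1$. Then for every $z\in\mathbb{C}-f^{-1}(f(0))$ and every $n\in\mathbb{Z}^+$, $$a_n=(-1)^n\big(f(0)-f(z)\big)\sum_{0\le i_1<i_2<\cdots<i_n}\Big(\prod_{j=1}^n\phi_{0i_j}(z)\Big)^{-1}.$$
   Context: ${\rm Aut}(f)=\{\phi_{0n}\}_n$ denotes the automorphic functions of $f$ (branches of $f^{-1}\circ f$, solutions of $f(\phi(z))=f(z)$); for fixed $z$, $\{\phi_{0n}(z)\}_{n\ge 0}$ is the set of zeros of $w\mapsto f(w)-f(z)$ listed with multiplicity (all nonzero when $f(z)\ne f(0)$). *)

(* Defs.v *)
From HB Require Import structures.
From mathcomp Require Import all_boot all_order all_algebra.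
From mathcomp Require Import all_classical all_reals all_analysis.
From mathcomp Require Export complex.
Import Order.TTheory GRing.Theory Num.Theory.
Import numFieldNormedType.Exports.

Set Implicit Arguments.
Unset Strict Implicit.
Unset Printing Implicit Defensive.

Local Open Scope ring_scope.
Local Open Scope classical_set_scope.

HB.instance Definition _ (R : realType) := NormedModule.copy R[i] (R[i])^o.

Definition cmod (R : realType) (w : R[i]) : R := ComplexField.Normc.normc w.

Definition entire_series (R : realType) (a : nat -> R[i]) (f : R[i] -> R[i]) :=
  forall w : R[i], series (fun k => a k * w ^+ k) @ \oo --> f w.

(* Set of exponents l >= 0 with  max_{|w|=r} |f(w)| <= exp(r^l)  for all
   large r; the order of f is the infimum of this set (f has finite order
   iff the set is nonempty). *)
Definition order_exponents (R : realType) (f : R[i] -> R[i]) : set R :=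
  [set l : R | 0 <= l /\
     \forall r \near +oo, forall w : R[i], cmod w = r ->
        cmod (f w) <= expR (r `^ l)].

Definition entire_order (R : realType) (f : R[i] -> R[i]) (rho : R) : Prop :=
  order_exponents f !=set0 /\ rho = inf (order_exponents f).

(* w0 is a zero of g of multiplicity m (m = 0 means g w0 <> 0):
   g(w) = (w - w0)^m h(w) with h continuous at w0 and h(w0) <> 0. *)
Definition zero_mult (R : realType) (g : R[i] -> R[i]) (w0 : R[i]) (m : nat) :=
  exists h : R[i] -> R[i],
    {for w0, continuous h} /\ h w0 != 0 /\
    forall w, g w = (w - w0) ^+ m * h w.

(* Index set of a (finite or infinite) listing: {0,...,m-1} if N = Some m,
   all of nat if N = None. *)
Definition idx (N : option nat) (k : nat) : bool :=
  if N is Some m then (k < m)%N else true.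

Definition zeros_listing (R : realType) (g : R[i] -> R[i])
    (N : option nat) (phi : nat -> R[i]) : Prop :=
  forall (w : R[i]) (m : nat), zero_mult g w m ->
    ([set k | idx N k /\ phi k = w] #= `I_m)%card.

Definition trunc (N : option nat) (M : nat) : nat :=
  if N is Some m then minn M m else M.

(* sum over 0 <= i_1 < ... < i_n < M of (prod_j phi(i_j))^-1 *)
Definition esym_inv (R : realType) (phi : nat -> R[i]) (n M : nat) : R[i] :=
  \sum_(S : {set 'I_M} | #|S| == n) (\prod_(i in S) phi i)^-1.

(* Main.v *)
Require Import Defs.
From HB Require Import structures.
From mathcomp Require Import all_boot all_order all_algebra all_solvable all_field.
From mathcomp Require Import all_classical all_reals all_analysis.
From mathcomp Require Import complex.
From mathcomp Require Import ring lra.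
Import Order.TTheory GRing.Theory Num.Theory.
Import numFieldNormedType.Exports.
Local Open Scope ring_scope.
Local Open Scope classical_set_scope.

(* The function [G = (f - f z) / (f 0 - f z)] is entire of order less than 1 with
   [G 0 = 1], and the formula says that [G] is the product of the [1 - w / phi_k]
   (Hadamard's factorization in genus 0), read off on Taylor coefficients.

   Contour integrals are replaced by averages over roots of unity, which give
   Cauchy's coefficient estimate and Carathéodory's inequality for polynomials,
   hence for power series by truncation.  Dividing [G] by the factors of the
   zeros in the disc of radius [2^j] leaves an entire function [H]; estimating
   [H 0 = 1] on the circle of radius [4 * 2^j], where each factor is at least 2,
   bounds the number of these zeros by [O(b^j)] with [b < 2], so the [1 / phi_k]
   are absolutely summable.  As [H] has no zeros in the disc, its Taylor
   polynomials of large degree have none either and split into factors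
   [1 - b_i w] with [|b_i|] small; the Carathéodory inequality for
   [ln |1 - b_i w|] bounds the power sums of the [b_i], and Newton's identities
   then bound the coefficients of [H] by [((1 + 2 L) / 2^j)^n], where
   [L = O(b^j)] is the logarithm of the maximum of [H].  Thus [H] tends to 1 and
   the products over the zeros tend to [G]. *)

Set Implicit Arguments.
Unset Strict Implicit.

Local Notation Re := complex.Re.
Local Notation Im := complex.Im.

(** * Modulus and real part of complex numbers *)

Lemma normc_cmod (R : realType) (w : R[i]) : `|w| = (cmod w)%:C%C.
Proof. by []. Qed.

Lemma cmod_ge0 (R : realType) (w : R[i]) : 0 <= cmod w.
Proof. by rewrite -ler0c -normc_cmod. Qed.

Lemma cmod0 (R : realType) : cmod (0 : R[i]) = 0.
Proof. exact: ComplexField.Normc.normc0. Qed.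

Lemma cmod1 (R : realType) : cmod (1 : R[i]) = 1.
Proof. exact: ComplexField.Normc.normc1. Qed.

Lemma cmodM (R : realType) (x y : R[i]) : cmod (x * y) = cmod x * cmod y.
Proof. exact: ComplexField.Normc.normcM. Qed.

Lemma cmodV (R : realType) (x : R[i]) : cmod x^-1 = (cmod x)^-1.
Proof. exact: ComplexField.Normc.normcV. Qed.

Lemma cmodN (R : realType) (x : R[i]) : cmod (- x) = cmod x.
Proof. exact: normcN. Qed.

Lemma cmodX (R : realType) (x : R[i]) n : cmod (x ^+ n) = cmod x ^+ n.
Proof. by elim: n => [|n IH]; rewrite ?expr0 ?cmod1 // !exprS cmodM IH. Qed.

Lemma cmodC (R : realType) (x : R) : cmod (x%:C%C) = `|x|.
Proof. by rewrite /cmod /= expr0n addr0 sqrtr_sqr. Qed.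

Lemma cmod_eq0 (R : realType) (x : R[i]) : (cmod x == 0) = (x == 0).
Proof.
apply/eqP/eqP => [|->]; last exact: cmod0.
exact: ComplexField.Normc.eq0_normc.
Qed.

Lemma cmod_gt0 (R : realType) (x : R[i]) : (0 < cmod x) = (x != 0).
Proof. by rewrite lt_def cmod_ge0 andbT cmod_eq0. Qed.

Lemma ler_cmodD (R : realType) (x y : R[i]) : cmod (x + y) <= cmod x + cmod y.
Proof. exact: le_normcD. Qed.

Lemma ler_cmodB (R : realType) (x y : R[i]) : cmod (x - y) <= cmod x + cmod y.
Proof. by rewrite -(cmodN y); exact: ler_cmodD. Qed.

Lemma cmod_distC (R : realType) (x y : R[i]) : cmod (x - y) = cmod (y - x).
Proof. by rewrite -cmodN opprB. Qed.

Lemma lerB_cmod (R : realType) (x y : R[i]) : cmod x - cmod y <= cmod (x - y).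
Proof. by rewrite lerBlDr -{1}(subrK y x); exact: ler_cmodD. Qed.

Lemma ler_cmod_sum (R : realType) (I : Type) (r : seq I) (P : pred I)
    (F : I -> R[i]) :
  cmod (\sum_(i <- r | P i) F i) <= \sum_(i <- r | P i) cmod (F i).
Proof.
elim/big_rec2: _ => [|i y x _ IH]; first by rewrite cmod0.
by rewrite (le_trans (ler_cmodD _ _))// lerD2l.
Qed.

Lemma cmod_prod (R : realType) (I : Type) (r : seq I) (F : I -> R[i]) :
  cmod (\prod_(i <- r) F i) = \prod_(i <- r) cmod (F i).
Proof. exact: (big_morph _ (@cmodM R) (@cmod1 R)). Qed.

Lemma cmod_natr (R : realType) n : cmod (n%:R : R[i]) = n%:R.
Proof.
have -> : (n%:R : R[i]) = (n%:R : R)%:C%C by rewrite rmorph_nat.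
by rewrite cmodC ger0_norm.
Qed.

Lemma ReD (R : realType) (x y : R[i]) : Re (x + y) = Re x + Re y.
Proof. by case: x => a b; case: y. Qed.

Lemma ReN (R : realType) (x : R[i]) : Re (- x) = - Re x.
Proof. by case: x. Qed.

Lemma Re_sum (R : realType) (I : Type) (r : seq I) (P : pred I) (F : I -> R[i]) :
  Re (\sum_(i <- r | P i) F i) = \sum_(i <- r | P i) Re (F i).
Proof. exact: (big_morph _ (@ReD R) (erefl : Re (0 : R[i]) = 0)). Qed.

Lemma ReMr (R : realType) (x : R) (y : R[i]) : Re (x%:C%C * y) = x * Re y.
Proof. by case: y => a b /=; rewrite mul0r subr0. Qed.

Lemma ler_normRe (R : realType) (x : R[i]) : `|Re x| <= cmod x.
Proof. by rewrite -lecR -normc_cmod; exact: normc_ge_Re. Qed.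

Lemma ler_normIm (R : realType) (x : R[i]) : `|Im x| <= cmod x.
Proof.
case: x => x y; rewrite /cmod /= -sqrtr_sqr ler_sqrt ?addr_ge0 ?sqr_ge0 //.
by rewrite lerDr sqr_ge0.
Qed.

Lemma ler_cmodReIm (R : realType) (x : R[i]) : cmod x <= `|Re x| + `|Im x|.
Proof.
rewrite {1}[x]complexE (le_trans (ler_cmodD _ _)) // cmodM !cmodC.
by rewrite /cmod /= expr0n /= expr1n add0r sqrtr1 mul1r.
Qed.

Lemma cmod_sqr (R : realType) (x : R[i]) : cmod x ^+ 2 = Re x ^+ 2 + Im x ^+ 2.
Proof. by case: x => x y; rewrite /cmod sqr_sqrtr // addr_ge0 ?sqr_ge0. Qed.

(** * Averages over roots of unity *)

(** As [n] is invertible, ['X^n - 1] is separable and has [n] distinct roots, which forces one of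
    them to be primitive. *)
Lemma exists_prim_root (F : closedFieldType) n :
  (0 < n)%N -> n%:R != 0 :> F -> exists z : F, n.-primitive_root z.
Proof.
move=> n_gt0 n_neq0; pose p : {poly F} := 'X^n - 1.
have [r Dp] := closed_field_poly_normal p.
rewrite (monicP _) ?monicXnsubC // scale1r in Dp.
have rn1 : all n.-unity_root r by apply/allP=> z; rewrite -root_prod_XsubC -Dp.
have sz_r : (n <= size r)%N.
  by rewrite -ltnS -(size_prod_XsubC r id) -Dp size_XnsubC.
have [|z _ zP] := hasP (has_prim_root n_gt0 rn1 _ sz_r); last by exists z.
by rewrite -separable_prod_XsubC -Dp separable_Xn_sub_1.
Qed.

Lemma cmod_unity_root (R : realType) (z : R[i]) n :
  (0 < n)%N -> z ^+ n = 1 -> cmod z = 1.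
Proof.
move=> n0 zn; apply/eqP; rewrite -(@pexpr_eq1 _ _ n) ?cmod_ge0 //.
by rewrite -cmodX zn cmod1.
Qed.

Lemma sum_prim_root_expr (F : fieldType) (z : F) n m : n.-primitive_root z ->
  \sum_(j < n) (z ^+ j) ^+ m = if (n %| m)%N then n%:R else 0.
Proof.
move=> zP; under eq_bigr do rewrite exprAC.
case: ifP => nm.
  have -> : z ^+ m = 1.
    by apply/eqP; rewrite -(prim_order_dvd zP).
  by rewrite (eq_bigr (fun=> 1)) ?sumr_const ?card_ord // => i _; rewrite expr1n.
have zm : z ^+ m - 1 != 0.
  by rewrite subr_eq0 -(prim_order_dvd zP) nm.
apply: (mulfI zm); rewrite mulr0 -subrX1 exprAC (prim_expr_order zP).
by rewrite expr1n subrr.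
Qed.

Lemma sum_prim_root_horner (F : fieldType) (z : F) n (p : {poly F}) e :
  n.-primitive_root z ->
  \sum_(j < n) p.[z ^+ j] * (z ^+ j) ^+ e =
  n%:R * \sum_(m < size p | (n %| m + e)%N) p`_m.
Proof.
move=> zP; under eq_bigr do rewrite horner_coef mulr_suml.
rewrite exchange_big /= mulr_sumr [RHS]big_mkcond /=.
apply: eq_bigr => m _; under eq_bigr do rewrite -mulrA -exprD.
rewrite -mulr_sumr sum_prim_root_expr //.
by case: ifP => _; rewrite ?mulr0 // mulrC.
Qed.

Lemma sum_prim_root_coef (F : fieldType) (z : F) n (p : {poly F}) k :
  n.-primitive_root z -> (size p <= n)%N -> (k < n)%N ->
  \sum_(j < n) p.[z ^+ j] * (z ^+ j) ^+ (n - k) = n%:R * p`_k.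
Proof.
move=> zP pn kn; rewrite sum_prim_root_horner //; congr (_ * _).
(* The exponent [n - k] stands for [-k]; since [0 < m + (n - k) < 2 * n], divisibility by [n] leaves
   only [m = k]. *)
have mP m : (m < size p)%N -> (n %| m + (n - k))%N = (m == k).
  move=> mp; have mn : (m < n)%N by rewrite (leq_trans mp).
  rewrite addnBA 1?ltnW //; have [mk|km|->] := ltngtP m k; last 2 first.
  - rewrite addnC -addnBA 1?ltnW // dvdn_addr // gtnNdvd ?subn_gt0 //.
    by rewrite (leq_ltn_trans _ mn) // leq_subr.
  - by rewrite addKn dvdnn.
  - rewrite gtnNdvd //; first by rewrite subn_gt0 ltn_addl.
    by rewrite ltn_subLR ?ltn_add2r // ltnW // ltn_addl.
have [kp|pk] := ltnP k (size p).
  rewrite (bigD1 (Ordinal kp)) /= ?mP // big1 ?addr0 //.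
  by move=> [m mp] /=; rewrite mP // -val_eqE /= => /andP[->].
rewrite nth_default // big_pred0 // => -[m mp] /=; rewrite mP //.
by apply/negbTE; rewrite neq_ltn (leq_trans mp).
Qed.

(** With [N] at least [size p] and above [n], averaging over the [N]-th roots of unity isolates the
    coefficient exactly, and each averaged value has modulus at most [B]. *)
Lemma coef_le_circle_sup (R : realType) (p : {poly R[i]}) (B : R) n :
  (forall w, cmod w = 1 -> cmod p.[w] <= B) -> cmod p`_n <= B.
Proof.
move=> pB; pose N := (size p + n.+1)%N.
have N0 : (0 < N)%N by rewrite /N addnS.
have [z zP] : exists z : R[i], N.-primitive_root z.
  by apply: exists_prim_root => //; rewrite pnatr_eq0 -lt0n.
have zj1 j : cmod (z ^+ j) = 1.
  by rewrite cmodX (cmod_unity_root N0) ?expr1n // (prim_expr_order zP).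
have sumE : \sum_(j < N) p.[z ^+ j] * (z ^+ j) ^+ (N - n) = N%:R * p`_n.
  by rewrite sum_prim_root_coef ?leq_addr // /N addnS ltnS leq_addl.
have : cmod (N%:R * p`_n) <= N%:R * B.
  rewrite -sumE (le_trans (ler_cmod_sum _ _ _)) //.
  have -> : N%:R * B = \sum_(i < N) B by rewrite sumr_const card_ord mulr_natl.
  by apply: ler_sum => j _; rewrite cmodM cmodX zj1 expr1n mulr1 pB.
by rewrite cmodM cmod_natr ler_pM2l // ltr0n.
Qed.

(* Carathéodory's inequality: [L + Re Q] is nonnegative with mean value [L],
   and its [k]-th Fourier coefficient is half of [Q`_k]. *)
Lemma coef_le_Re_inf (R : realType) (Q : {poly R[i]}) (L : R) k :
  Q`_0 = 0 -> (0 < k)%N ->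
  (forall w, cmod w = 1 -> - Re Q.[w] <= L) -> cmod Q`_k <= 2 * L.
Proof.
move=> Q0 k0 QL; pose N := (size Q + k.+1)%N.
have N0 : (0 < N)%N by rewrite /N addnS.
have kN : (k < N)%N by rewrite /N addnS ltnS leq_addl.
have [z zP] : exists z : R[i], N.-primitive_root z.
  by apply: exists_prim_root => //; rewrite pnatr_eq0 -lt0n.
have zN j : (z ^+ j) ^+ N = 1 by rewrite exprAC (prim_expr_order zP) expr1n.
have zj1 j : cmod (z ^+ j) = 1 by exact: cmod_unity_root N0 (zN j).
have conjz j : (((z ^+ j) ^+ (N - k))^*)%C = (z ^+ j) ^+ k.
  have w0 : (z ^+ j) ^+ (N - k) != 0.
    by rewrite !expf_neq0 // -cmod_gt0 -(expr1 z) zj1.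
  apply: (mulfI w0); rewrite -exprD subnK 1?ltnW // zN -sqr_normc normc_cmod.
  by rewrite cmodX zj1 expr1n expr1n.
have S0 : \sum_(j < N) Q.[z ^+ j] = 0.
  have := sum_prim_root_horner Q 0 zP.
  rewrite (eq_bigr (fun j : 'I_N => Q.[z ^+ j])); last first.
    by move=> j _; rewrite expr0 mulr1.
  move=> ->; rewrite big1 ?mulr0 // => -[[|m] mp] //=.
  by rewrite addn0 gtnNdvd // (leq_trans mp) // leq_addr.
(* The frequency [+k] meets no coefficient, as [0 < m + k < N]. Adding the conjugate of this null
   sum at frequency [N - k] replaces [Q] by [2 * Re Q]. *)
have Sk : \sum_(j < N) Q.[z ^+ j] * (z ^+ j) ^+ k = 0.
  rewrite sum_prim_root_horner // big1 ?mulr0 // => -[m mp] /=.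
  by rewrite gtnNdvd ?addn_gt0 ?k0 ?orbT // /N addnS ltnS leq_add2r ltnW.
have SNk : \sum_(j < N) Q.[z ^+ j] * (z ^+ j) ^+ (N - k) = N%:R * Q`_k.
  by rewrite sum_prim_root_coef ?leq_addr.
pose x j := L + Re Q.[z ^+ j].
have x0 j : 0 <= x j by rewrite /x -lerBlDr sub0r QL.
have sx : \sum_(j < N) x j = N%:R * L.
  by rewrite big_split /= sumr_const card_ord -Re_sum S0 addr0 mulr_natl.
have sxk : 2 * \sum_(j < N) (x j)%:C%C * (z ^+ j) ^+ (N - k) = N%:R * Q`_k.
  have {}Sk : \sum_(j < N) (Q.[z ^+ j] * (z ^+ j) ^+ k)^*%C = 0.
    by have := congr1 (@conjc R) Sk; rewrite conjc0 rmorph_sum.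
  rewrite -SNk -[RHS]addr0 -[X in _ = _ + X]Sk.
  rewrite -big_split /= mulr_sumr.
  rewrite (eq_bigr (fun j : 'I_N => 2 * L%:C%C * (z ^+ j) ^+ (N - k) +
     (Q.[z ^+ j] * (z ^+ j) ^+ (N - k) +
      (Q.[z ^+ j])^*%C * (z ^+ j) ^+ (N - k)))).
    rewrite big_split /= -mulr_sumr sum_prim_root_expr // gtnNdvd ?subn_gt0 //.
      rewrite mulr0 add0r; apply: eq_bigr => j _; rewrite rmorphM /= -conjz.
      by rewrite conjcK.
    by rewrite -[X in (_ < X)%N](subnK (ltnW kN)) -addn1 leq_add2l.
  move=> j _; rewrite -mulrDl addcJ -mulrDl -mulrDr mulrA.
  by rewrite -rmorphD.
have : cmod (N%:R * Q`_k) <= 2 * (N%:R * L).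
  rewrite -sxk cmodM cmod_natr -sx ler_pM2l // (le_trans (ler_cmod_sum _ _ _)) //.
  by apply: ler_sum => j _; rewrite cmodM cmodX zj1 expr1n mulr1 cmodC ger0_norm.
by rewrite cmodM cmod_natr mulrCA ler_pM2l // ltr0n.
Qed.

(** * Logarithms and power sums of polynomials without zeros in the disc *)

Lemma geometric_small (R : realType) (C q e : R) : 0 <= q < 1 -> 0 < e ->
  exists n0, forall n, (n0 <= n)%N -> C * q ^+ n <= e.
Proof.
move=> /andP[q0 q1] e0.
have : geometric C q @ \oo --> 0 by apply: cvg_geometric; rewrite ger0_norm.
move/cvgrPdist_le => /(_ _ e0)[n0 _ n0P]; exists n0 => n /n0P /=.
by rewrite sub0r normrN; apply: le_trans; exact: ler_norm.
Qed.

(** Along the segment [t * w], the derivative of the difference [D] collapses, by the geometric sum,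
    to [- Re (w * (t * w) ^+ T / (1 - t * w))]. The mean value theorem on [[0, 1]] then bounds
    [D 1], with the real logarithm only. *)
Lemma ln_cmod_one_sub (R : realType) (w : R[i]) T : cmod w < 1 ->
  `|ln (cmod (1 - w)) + Re (\sum_(m < T) w ^+ m.+1 / m.+1%:R)|
    <= cmod w ^+ T.+1 / (1 - cmod w).
Proof.
move=> w1.
have tw1 (t : R) : 0 <= t <= 1 -> cmod (t%:C%C * w) <= cmod w.
  move=> /andP[t0 t1]; rewrite cmodM cmodC ger0_norm // ler_piMl ?cmod_ge0 //.
have tw_gt0 (t : R) : 0 <= t <= 1 -> 1 - cmod w <= cmod (1 - t%:C%C * w).
  move=> t01; apply: le_trans (lerB_cmod _ _); rewrite cmod1.
  by rewrite lerD2l lerN2 tw1.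
have w_gt0 : 0 < 1 - cmod w by rewrite subr_gt0.
(* [q.[t]] is the square of [|1 - t * w|], so half of its logarithm is the function wanted and [q]
   is a real polynomial in [t]. *)
pose q : {poly R} := 1 - (Re w *+ 2) *: 'X + (cmod w ^+ 2) *: 'X^2.
have qE t : q.[t] = cmod (1 - t%:C%C * w) ^+ 2.
  rewrite cmod_sqr /q !hornerE cmod_sqr; case: (w) => x y /=.
  ring.
pose P : {poly R} := \sum_(m < T) (Re (w ^+ m.+1) / m.+1%:R) *: 'X^(m.+1).
have PE t : P^`().[t] = \sum_(m < T) Re (w ^+ m.+1) * t ^+ m.
  rewrite /P raddf_sum horner_sum; apply: eq_bigr => m _.
  rewrite /= linearZ /= derivXn /= hornerZ hornerMn hornerXn -mulr_natr.
  by set u := t ^+ m; field; rewrite addrC natr1 pnatr_eq0.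
have P1 : P.[1] = Re (\sum_(m < T) w ^+ m.+1 / m.+1%:R).
  rewrite /P horner_sum Re_sum; apply: eq_bigr => m _.
  rewrite hornerZ hornerXn expr1n mulr1 mulrC.
  have -> : (m.+1%:R^-1 : R[i]) = ((m.+1%:R)^-1 : R)%:C%C.
    by rewrite fmorphV rmorph_nat.
  by rewrite [in RHS]mulrC ReMr.
have P0 : P.[0] = 0.
  by rewrite /P horner_sum big1 // => m _; rewrite hornerZ hornerXn expr0n mulr0.
pose D : R -> R := (2^-1 : R) *: (@ln R \o horner q) + horner P.
pose dD t := 2^-1 * ((q.[t])^-1 * q^`().[t]) + P^`().[t].
have D1 : D 1 = ln (cmod (1 - w)) + Re (\sum_(m < T) w ^+ m.+1 / m.+1%:R).
  rewrite /D /= !fctE /= P1 qE mul1r lnXn.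
    by congr (_ + _); rewrite [LHS](_ : _ = 2^-1 * (ln (cmod (1 - w)) *+ 2)) //; field.
  by rewrite (lt_le_trans w_gt0) // -[w in leRHS]mul1r tw_gt0 ?ler01 ?lexx.
have D0 : D 0 = 0.
  by rewrite /D !fctE /= P0 qE mul0r subr0 cmod1 expr1n ln1 scaler0 addr0.
have q_gt0 (t : R) : 0 <= t <= 1 -> 0 < q.[t].
  by move=> /tw_gt0 t01; rewrite qE exprn_gt0 // (lt_le_trans w_gt0).
have derD (t : R) : 0 <= t <= 1 -> is_derive t 1 D (dD t).
  move=> t01; apply: is_deriveD; apply: is_deriveZ; apply: is_derive1_comp.
  exact: is_derive1_ln (q_gt0 _ t01).
have dDE (t : R) : 0 <= t <= 1 ->
    dD t = - Re (w * (t%:C%C * w) ^+ T / (1 - t%:C%C * w)).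
  move=> t01; rewrite /dD.
  have u0 : 1 - t%:C%C * w != 0.
    by rewrite -cmod_gt0 (lt_le_trans w_gt0) ?tw_gt0.
  have -> : P^`().[t] = Re (w * (1 - (t%:C%C * w) ^+ T) / (1 - t%:C%C * w)).
    have -> : 1 - (t%:C%C * w) ^+ T =
        (1 - t%:C%C * w) * \sum_(m < T) (t%:C%C * w) ^+ m.
      by rewrite -opprB subrX1 -mulNr opprB.
    rewrite PE [w * _]mulrCA [_ * (w * _)]mulrC mulfK //.
    rewrite mulr_sumr Re_sum; apply: eq_bigr => m _.
    by rewrite exprMn mulrCA -exprS -rmorphXn ReMr mulrC.
  have -> : 2^-1 * ((q.[t])^-1 * q^`().[t]) = - Re (w / (1 - t%:C%C * w)).
    have -> : q^`().[t] = - 2 * Re (w * ((1 - t%:C%C * w)^*)%C).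
      rewrite /q !(poly.derivE, hornerE) /= cmod_sqr; case: (w) => x y /=.
      ring.
    rewrite qE; move: u0; set u := 1 - _ => u0.
    have -> : w / u = ((cmod u ^+ 2)^-1)%:C%C * (w * (u^*)%C).
      by rewrite invc_norm normc_cmod fmorphV rmorphXn mulrCA.
    by rewrite ReMr; field; rewrite cmod_eq0.
  rewrite mulrBr mulr1 mulrBl ReD ReN; ring.
have /(_ _) [||c /[!in_itv]/= c01] := @MVT_segment R D dD 0 1 ler01.
- by move=> x; rewrite in_itv /= => /andP[/ltW x0 /ltW x1]; apply: derD; rewrite x0.
- apply: derivable_within_continuous => x; rewrite in_itv /= => x01.
  by have [] := derD x x01.
rewrite D0 !subr0 mulr1 -D1 => ->; rewrite dDE // normrN.
rewrite (le_trans (ler_normRe _)) // !cmodM cmodX cmodV exprS.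
rewrite ler_pM ?mulr_ge0 ?exprn_ge0 ?invr_ge0 ?cmod_ge0 //.
  by rewrite ler_wpM2l ?cmod_ge0 // lerXn2r ?nnegrE ?cmod_ge0 // tw1.
by rewrite lef_pV2 ?posrE ?tw_gt0 // (lt_le_trans w_gt0) // tw_gt0.
Qed.

Lemma sum_geometric_small (R : realType) (s : seq R[i]) (e : R) :
  (forall b, b \in s -> cmod b < 1) -> 0 < e ->
  exists n0, forall n, (n0 <= n)%N ->
    \sum_(b <- s) cmod b ^+ n / (1 - cmod b) <= e.
Proof.
elim: s e => [|b s IH] e sP e0; first by exists 0%N => n _; rewrite big_nil ltW.
have e2 : 0 < e / 2 by rewrite divr_gt0.
have [|n1 n1P] := IH _ _ e2; first by move=> c cs; rewrite sP // inE cs orbT.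
have [|n2 n2P] := @geometric_small R (1 - cmod b)^-1 (cmod b) _ _ e2.
  by rewrite cmod_ge0 sP // mem_head.
exists (maxn n1 n2) => n; rewrite geq_max => /andP[/n1P sn /n2P bn].
by rewrite big_cons [e]splitr lerD // mulrC.
Qed.

(** The polynomial [Q] is a truncation of minus the logarithm of the product: its coefficient of
    index [k.+1] is the power sum over [k.+1], and on the unit circle [- Re Q] is at most [L] up to
    a small error, so Carathéodory's inequality applies. *)
Lemma power_sum_bound (R : realType) (s : seq R[i]) (L : R) k :
  (forall b, b \in s -> cmod b < 1) ->
  (forall w, cmod w = 1 -> cmod (\prod_(b <- s) (1 - b * w)) <= expR L) ->
  cmod (\sum_(b <- s) b ^+ k.+1) <= 2 * k.+1%:R * L.
Proof.
move=> s1 sL; apply/ler_addgt0Pr => e e0.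
(* Carathéodory's factor 2 and the denominator [k.+1] will multiply the truncation error by
   [2 * k.+1]. *)
have e2 : 0 < e / (2 * k.+1%:R) by rewrite divr_gt0 ?mulr_gt0 ?ltr0n.
have [n0 n0P] := sum_geometric_small s1 e2.
pose T := maxn n0 k.+1.
pose Q : {poly R[i]} :=
  \sum_(b <- s) \sum_(m < T) (b ^+ m.+1 / m.+1%:R) *: 'X^(m.+1).
have Qcoef j : Q`_j = \sum_(b <- s) \sum_(m < T)
    (b ^+ m.+1 / m.+1%:R) * (j == m.+1)%:R.
  rewrite coef_sum; apply: eq_bigr => b _.
  by rewrite coef_sum; apply: eq_bigr => m _; rewrite coefZ coefXn.
have kT : (k < T)%N by rewrite leq_max leqnn orbT.
have Qk : Q`_k.+1 = (\sum_(b <- s) b ^+ k.+1) / k.+1%:R.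
  rewrite Qcoef mulr_suml; apply: eq_bigr => b _.
  rewrite (bigD1 (Ordinal kT)) //= eqxx mulr1 big1 ?addr0 // => m mk.
  by rewrite eqSS eq_sym [_ == _](negbTE mk) mulr0.
have Q0 : Q`_0 = 0.
  by rewrite Qcoef big1 // => b _; rewrite big1 // => m _; rewrite mulr0.
have Qhor w : Q.[w] = \sum_(b <- s) \sum_(m < T) (b * w) ^+ m.+1 / m.+1%:R.
  rewrite horner_sum; apply: eq_bigr => b _; rewrite horner_sum.
  by apply: eq_bigr => m _; rewrite hornerZ hornerXn exprMn mulrAC.
have := @coef_le_Re_inf R Q (L + e / (2 * k.+1%:R)) k.+1 Q0 isT.
rewrite Qk cmodM cmodV cmod_natr ler_pdivrMr ?ltr0n //.
have -> : 2 * (L + e / (2 * k.+1%:R)) * k.+1%:R = 2 * k.+1%:R * L + e.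
  by field; rewrite addrC natr1 pnatr_eq0.
apply => w w1.
have cbw b : cmod (b * w) = cmod b by rewrite cmodM w1 mulr1.
have pos b : b \in s -> 0 < cmod (1 - b * w).
  move=> bs; apply: lt_le_trans (lerB_cmod _ _).
  by rewrite cmod1 cbw subr_gt0 s1.
have lnL : \sum_(b <- s) ln (cmod (1 - b * w)) <= L.
  have -> : \sum_(b <- s) ln (cmod (1 - b * w)) =
      ln (cmod (\prod_(b <- s) (1 - b * w))).
    rewrite cmod_prod; elim: (s) pos => [|b r IH] pos; first by rewrite !big_nil ln1.
    have posr c : c \in r -> 0 < cmod (1 - c * w).
      by move=> cr; rewrite pos // inE cr orbT.
    rewrite !big_cons lnM ?posrE ?pos ?mem_head ?IH //.
    by rewrite big_seq prodr_gt0.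
  rewrite -[L]expRK ler_ln ?posrE ?expR_gt0 ?sL // cmod_gt0.
  rewrite prodf_seq_neq0; apply/allP => b bs /=.
  by rewrite -cmod_gt0 pos.
have n0T : (n0 <= T.+1)%N by rewrite leqW // leq_maxl.
rewrite Qhor Re_sum; apply: le_trans (lerD lnL (n0P _ n0T)).
rewrite -sumrN -big_split /= big_seq [leRHS]big_seq; apply: ler_sum => b bs.
have := @ln_cmod_one_sub R (b * w) T; rewrite cbw s1 // => /(_ isT).
by rewrite ler_norml => /andP[+ _]; lra.
Qed.

Lemma coef_one_sub_mul (F : comNzRingType) (b : F) (p : {poly F}) n :
  ((1 - b *: 'X) * p)`_n = p`_n - (if n is m.+1 then b * p`_m else 0).
Proof.
rewrite mulrBl mul1r coefB -scalerAl coefZ coefXM.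
by case: n => [|n] /=; rewrite ?mulr0.
Qed.

(** This is [p' = - p * sum_b b / (1 - b X)] read on coefficients. In the induction on [s], [geo]
    expresses that [b / (1 - b X)] times [q] is [b * p]. *)
Lemma newton_identity (F : comNzRingType) (s : seq F) n :
  let p := \prod_(b <- s) (1 - b *: 'X) in
  n.+1%:R * p`_n.+1 = - \sum_(k < n.+1) (\sum_(b <- s) b ^+ k.+1) * p`_(n - k).
Proof.
elim: s n => [|b s IH] n /=.
  rewrite big_nil coef1 mulr0 big1 ?oppr0 // => k _.
  by rewrite big_nil mul0r.
pose p : {poly F} := \prod_(b <- s) (1 - b *: 'X).
rewrite big_cons -/p; pose q := (1 - b *: 'X) * p; rewrite -/q.
have qE := coef_one_sub_mul b p.
have geo m : \sum_(k < m.+1) b ^+ k.+1 * q`_(m - k) = b * p`_m.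
  elim: m => [|m IHm].
    by rewrite big_ord_recl big_ord0 addr0 expr1 /q qE subr0.
  rewrite big_ord_recl /= subn0 expr1 /q qE.
  under eq_bigr do rewrite /bump /= add1n subSS exprS -mulrA.
  by rewrite -mulr_sumr IHm mulrBr addrNK.
under eq_bigr do rewrite big_cons mulrDl.
rewrite big_split /= geo.
have -> : \sum_(k < n.+1) (\sum_(b <- s) b ^+ k.+1) * q`_(n - k) =
    \sum_(k < n.+1) (\sum_(b <- s) b ^+ k.+1) * p`_(n - k) + b * (n%:R * p`_n).
  case: n => [|n].
    by rewrite !big_ord_recl !big_ord0 /= /q qE subr0 mul0r mulr0 !addr0.
  rewrite (IH n) mulrN mulr_sumr [in RHS]big_ord_recr [in LHS]big_ord_recr /=.
  rewrite !subnn {1}/q qE subr0 [RHS]addrAC; congr (_ + _).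
  rewrite -sumrB; apply: eq_bigr => k _.
  rewrite /q qE subSn; last by rewrite -ltnS.
  by rewrite mulrBr [b * (_ * _)]mulrCA.
rewrite [n%:R * _]mulrC /q qE mulrBr IH -/p -natr1; ring.
Qed.

(* Borel–Carathéodory for a polynomial, with the roots written as [1 / b]. *)
Lemma coef_bound_zero_free_prod (R : realType) (s : seq R[i]) (L : R) n :
  (forall b, b \in s -> cmod b < 1) ->
  (forall w, cmod w = 1 -> cmod (\prod_(b <- s) (1 - b * w)) <= expR L) ->
  cmod (\prod_(b <- s) (1 - b *: 'X))`_n <= (1 + 2 * L) ^+ n.
Proof.
move=> s1 sL; set p : {poly R[i]} := \prod_(b <- s) _.
have L0 : 0 <= L.
  have := power_sum_bound 0 s1 sL; rewrite mulr1 => /(le_trans (cmod_ge0 _)).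
  by rewrite pmulr_rge0.
have p0 : p`_0 = 1.
  rewrite -horner_coef0 /p horner_prod big1_seq // => b _.
  by rewrite !hornerE ?mulr0 ?subr0.
have [m] := ubnP n; elim: m n => // m IH [|n] nm; first by rewrite p0 cmod1 expr0.
rewrite -(ler_pM2l (_ : 0 < n.+1%:R)) ?ltr0n //.
rewrite -{1}[n.+1%:R]cmod_natr -cmodM newton_identity -/p cmodN.
apply: le_trans (ler_cmod_sum _ _ _) _.
apply: (@le_trans _ _
  (\sum_(k < n.+1) (n.+1%:R * (2 * L)) * (1 + 2 * L) ^+ (n - k))).
  apply: ler_sum => k _; rewrite cmodM ler_pM ?cmod_ge0 //.
    apply: le_trans (power_sum_bound _ s1 sL) _.
    rewrite -mulrA [leRHS]mulrCA ler_pM2l // ler_wpM2r // ler_nat.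
    exact: ltn_ord.
  by rewrite IH // (leq_ltn_trans (leq_subr _ _)).
(* The geometric sum of ratio [1 + 2 * L], multiplied by [2 * L], is [(1 + 2 * L) ^+ n.+1 - 1]:
   hence the choice of base. *)
rewrite -mulr_sumr -mulrA ler_pM2l ?ltr0n //.
have := @subrX1 _ (1 + 2 * L) n.+1.
rewrite (_ : 1 + 2 * L - 1 = 2 * L); last by ring.
rewrite (reindex_inj rev_ord_inj) /=.
rewrite (eq_bigr (fun k : 'I_n.+1 => (1 + 2 * L) ^+ (n - k))) => [<-|k _].
  by rewrite gerBl.
by rewrite subSS.
Qed.

(** * Entire functions given by power series *)

(** The norm on [R[i]] takes values in [R[i]], so its epsilons are complex; positivity makes them
    real, and all later estimates use real ones. *)
Lemma cvg_cmodP (R : realType) (u : nat -> R[i]) (l : R[i]) :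
  u @ \oo --> l <->
  forall e : R, 0 < e ->
    exists n0, forall n, (n0 <= n)%N -> cmod (u n - l) <= e.
Proof.
split=> [/cvgrPdist_le ul e e0|ul].
  have /ul[n0 _ n0P] : 0 < e%:C%C by rewrite ltcR.
  by exists n0 => n /n0P /=; rewrite normc_cmod lecR cmod_distC.
apply/cvgrPdist_le => -[e ei]; rewrite ltcE /= => /andP[/eqP -> e0].
have [n0 n0P] := ul e e0.
by exists n0 => // n /= /n0P; rewrite normc_cmod lecR cmod_distC.
Qed.

Lemma cvg_cmod_unique (R : realType) (u : nat -> R[i]) (l l' : R[i]) :
  u @ \oo --> l -> u @ \oo --> l' -> l = l'.
Proof.
move=> /cvg_cmodP ul /cvg_cmodP ul'; apply/eqP; rewrite -subr_eq0 -cmod_eq0.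
rewrite eq_le cmod_ge0 andbT; apply/ler_addgt0Pr => e e0; rewrite add0r.
have e2 : 0 < e / 2 by rewrite divr_gt0.
have [n1 n1P] := ul _ e2; have [n2 n2P] := ul' _ e2.
pose n := maxn n1 n2.
have -> : l - l' = (l - u n) + (u n - l') by ring.
rewrite (le_trans (ler_cmodD _ _)) // [e]splitr lerD //.
  by rewrite cmod_distC n1P // leq_maxl.
by rewrite n2P // leq_maxr.
Qed.

Lemma sum_geometric_le (R : realType) (C q : R) m n : 0 <= C -> 0 <= q < 1 ->
  \sum_(m <= k < n) C * q ^+ k <= C * q ^+ m / (1 - q).
Proof.
move=> C0 /andP[q0 q1]; have q10 : 0 < 1 - q by rewrite subr_gt0.
have [nm|mn] := leqP n m.
  by rewrite big_geq // divr_ge0 ?mulr_ge0 ?exprn_ge0 // ltW.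
rewrite -mulr_sumr -(subnKC (ltnW mn)) geometric_partial_tail geometric_seriesE ?lt_eqF //=.
rewrite mulrA ler_pM2r ?invr_gt0 // ler_wpM2l //.
by rewrite ler_piMr ?exprn_ge0 // gerBl exprn_ge0.
Qed.

Lemma series_tail (R : realType) (u : nat -> R[i]) (v : R[i]) (C q : R) m :
  series u @ \oo --> v -> 0 <= C -> 0 <= q < 1 ->
  (forall k, (m <= k)%N -> cmod (u k) <= C * q ^+ k) ->
  cmod (v - \sum_(k < m) u k) <= C * q ^+ m / (1 - q).
Proof.
move=> /cvg_cmodP uv C0 q01 uC; apply/ler_addgt0Pl => e e0.
have [n0 n0P] := uv e e0; pose n := maxn n0 m.
have -> : v - \sum_(k < m) u k = (v - series u n) + \sum_(m <= k < n) u k.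
  rewrite /series /= -(big_mkord xpredT).
  rewrite (@big_cat_nat _ _ _ m 0%N n) ?leq_maxr //=.
  by ring.
rewrite (le_trans (ler_cmodD _ _)) // lerD //.
  by rewrite cmod_distC n0P // leq_maxl.
rewrite (le_trans (ler_cmod_sum _ _ _)) //.
apply: le_trans (sum_geometric_le m n C0 q01).
by rewrite big_nat_cond [leRHS]big_nat_cond; apply: ler_sum => k /andP[/andP[/uC]].
Qed.

(** Completeness of [R] is applied to the real and imaginary parts, both dominated by the same
    geometric series. *)
Lemma cvg_series_geometric (R : realType) (u : nat -> R[i]) (C q : R) :
  0 <= q < 1 -> (forall k, cmod (u k) <= C * q ^+ k) ->
  exists v : R[i], series u @ \oo --> v.
Proof.
move=> /andP[q0 q1] uC.
have C0 : 0 <= C by have := uC 0%N; rewrite expr0 mulr1; apply: le_trans (cmod_ge0 _).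
have part (x : nat -> R) : (forall k, `|x k| <= cmod (u k)) -> cvgn (series x).
  move=> xu; apply: normed_cvg.
  apply: (@series_le_cvg R _ (geometric C q)) => [k|k|k|] //=.
  - by rewrite mulr_ge0 ?exprn_ge0.
  - by rewrite (le_trans (xu k)).
  - by apply: is_cvg_geometric_series; rewrite ger0_norm.
have /cvg_ex[a /= /cvgrPdist_le aP] := part (fun k => Re (u k)) (fun=> ler_normRe _).
have /cvg_ex[b /= /cvgrPdist_le bP] := part (fun k => Im (u k)) (fun=> ler_normIm _).
exists (a +i* b)%C; apply/cvg_cmodP => e e0.
have e2 : 0 < e / 2 by rewrite divr_gt0.
have [n1 _ n1P] := aP _ e2; have [n2 _ n2P] := bP _ e2.
exists (maxn n1 n2) => n; rewrite geq_max => /andP[nn1 nn2].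
rewrite cmod_distC (le_trans (ler_cmodReIm _)) // [e]splitr lerD //.
  move: (n1P n nn1); congr (`|_| <= _); rewrite ReD ReN /=; congr (_ - _).
  by rewrite /series /= Re_sum.
move: (n2P n nn2); congr (`|_| <= _).
have ImB (x y : R[i]) : Im (x - y) = Im x - Im y by case: x; case: y.
have ImD (x y : R[i]) : Im (x + y) = Im x + Im y by case: x; case: y.
rewrite ImB /=; congr (_ - _).
by rewrite /series /= (big_morph _ ImD (erefl : Im (0 : R[i]) = 0)).
Qed.

(** Infinite radius of convergence as a condition on the coefficients alone; the next two lemmas
    show that it amounts to convergence everywhere. *)
Definition fast_decay (R : realType) (c : nat -> R[i]) :=
  forall r : R, 0 < r -> exists2 C, 0 <= C & forall n, cmod (c n) * r ^+ n <= C.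

Lemma entire_series_decay (R : realType) (c : nat -> R[i]) H :
  entire_series c H -> fast_decay c.
Proof.
move=> cH r r0; have /cvg_cmodP/(_ 1 ltr01)[n0 n0P] := cH (r%:C%C).
pose t n := cmod (c n) * r ^+ n.
have t0 n : 0 <= t n by rewrite mulr_ge0 ?cmod_ge0 ?exprn_ge0 // ltW.
(* From [n0] on, a term is the difference of two partial sums within 1 of the limit; the finite sum
   covers the earlier terms. *)
exists (2 + \sum_(i < n0) t i); first by rewrite addr_ge0 ?sumr_ge0.
move=> n; rewrite -/(t n); have [nn0|nn0] := ltnP n n0.
  rewrite (bigD1 (Ordinal nn0)) //= addrCA lerDl addr_ge0 ?sumr_ge0 //.
apply: (@le_trans _ _ 2); last by rewrite lerDl sumr_ge0.
have -> : t n = cmod (c n * (r%:C%C) ^+ n).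
  by rewrite cmodM cmodX cmodC gtr0_norm.
set u := fun k => c k * (r%:C%C) ^+ k in n0P.
have -> : c n * (r%:C%C) ^+ n = (series u n.+1 - H r%:C%C) - (series u n - H r%:C%C).
  by rewrite /series /= big_nat_recr //= /u; ring.
rewrite (le_trans (ler_cmodB _ _)) // (_ : 2 = 1 + 1) // lerD //.
  by rewrite n0P // leqW.
by rewrite n0P.
Qed.

Lemma entire_of_decay (R : realType) (c : nat -> R[i]) :
  fast_decay c -> exists H, entire_series c H.
Proof.
move=> cD.
have cv w : exists v : R[i], series (fun k => c k * w ^+ k) @ \oo --> v.
  (* Decay at twice the radius makes the series geometric of ratio 1/2; the [+ 1] keeps the radius
     positive at [w = 0]. *)
  have r0 : 0 < 2 * (cmod w + 1) by rewrite mulr_gt0 // ltr_wpDl ?cmod_ge0.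
  have [C C0 CP] := cD _ r0.
  apply: (@cvg_series_geometric R _ C (1 / 2)); first by lra.
  move=> k; rewrite cmodM cmodX; have wk : cmod w ^+ k <= (cmod w + 1) ^+ k.
    by rewrite lerXn2r ?nnegrE ?addr_ge0 ?cmod_ge0 // lerDl.
  apply: le_trans (_ : cmod (c k) * (cmod w + 1) ^+ k <= _).
    by rewrite ler_wpM2l ?cmod_ge0.
  rewrite -(ler_pM2r (_ : 0 < 2 ^+ k)) ?exprn_gt0 // -mulrA -exprMn.
  rewrite -mulrA -exprMn div1r mulVf ?pnatr_eq0 // expr1n mulr1.
  by rewrite [(_ + 1) * 2]mulrC CP.
by have [H HP] := choice cv; exists H => w; exact: HP.
Qed.

Lemma entire_tail (R : realType) (c : nat -> R[i]) H (r : R) :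
  entire_series c H -> 0 < r -> exists2 C, 0 <= C &
  forall m w, cmod w <= r -> cmod (H w - \sum_(k < m) c k * w ^+ k) <= C / 2 ^+ m.
Proof.
move=> cH r0; have r20 : 0 < 2 * r by rewrite mulr_gt0.
have [C C0 CP] := entire_series_decay cH r20.
exists (2 * C); first by rewrite mulr_ge0.
move=> m w wr.
have := @series_tail R _ _ C (1 / 2) m (cH w) C0.
have -> : C * (1 / 2) ^+ m / (1 - 1 / 2) = 2 * C / 2 ^+ m.
  by rewrite div1r exprVn; field; rewrite expf_neq0 ?pnatr_eq0.
apply; first by lra.
move=> k _; rewrite cmodM cmodX div1r exprVn.
rewrite ler_pdivlMr ?exprn_gt0 // -mulrA -exprMn (le_trans _ (CP k)) //.
rewrite ler_wpM2l ?cmod_ge0 // lerXn2r ?nnegrE ?mulr_ge0 ?cmod_ge0 //.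
  exact: ltW.
by rewrite mulrC ler_pM2l.
Qed.

Lemma entire_bounded (R : realType) (c : nat -> R[i]) H (r : R) :
  entire_series c H -> 0 < r -> exists2 C, 0 <= C &
  forall w, cmod w <= r -> cmod (H w) <= C.
Proof.
move=> cH r0; have [C C0 CP] := entire_tail cH r0; exists C => // w /(CP 0%N).
by rewrite big_ord0 subr0 expr0 divr1.
Qed.

Lemma entire_at0 (R : realType) (c : nat -> R[i]) H :
  entire_series c H -> H 0 = c 0%N.
Proof.
move=> cH; apply: (cvg_cmod_unique (cH 0)); apply/cvg_cmodP => e e0.
exists 1%N => -[//|n] _; rewrite /series /= big_nat_recl //= expr0 mulr1.
rewrite big1 ?addr0 ?subrr ?cmod0 ?ltW // => i _.
by rewrite exprS mul0r mulr0.
Qed.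

Lemma entire_scale (R : realType) (c : nat -> R[i]) H (r : R) :
  entire_series c H ->
  entire_series (fun n => c n * r%:C%C ^+ n) (fun w => H (r%:C%C * w)).
Proof.
move=> cH w; have := cH (r%:C%C * w).
by under eq_fun do rewrite exprMn mulrA.
Qed.

Lemma entire_seriesZ (R : realType) (c : nat -> R[i]) G (x : R[i]) :
  entire_series c G -> entire_series (fun n => x * c n) (fun w => x * G w).
Proof.
move=> cG w; apply/cvg_cmodP => e e0; have x1 : 0 < cmod x + 1.
  by rewrite ltr_wpDl ?cmod_ge0.
have /cvg_cmodP/(_ (e / (cmod x + 1))) [|n0 n0P] := cG w; first by rewrite divr_gt0.
exists n0 => n /n0P; rewrite ler_pdivlMr // => nP.
have -> : series (fun k => x * c k * w ^+ k) n = x * series (fun k => c k * w ^+ k) n.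
  by rewrite /series /= mulr_sumr; apply: eq_bigr => i _; rewrite mulrA.
rewrite -mulrBr cmodM mulrC (le_trans _ nP) // ler_wpM2l ?cmod_ge0 //.
by rewrite lerDl.
Qed.

(** After rescaling to the unit circle, a truncation beyond degree [n] keeps the coefficient and
    moves the values by at most an arbitrary [e], so the polynomial estimate carries over. *)
Lemma entire_coef_bound (R : realType) (c : nat -> R[i]) H (r B : R) n :
  entire_series c H -> 0 < r -> (forall w, cmod w = r -> cmod (H w) <= B) ->
  cmod (c n) * r ^+ n <= B.
Proof.
move=> cH r0 HB; have cHr := @entire_scale R c H r cH.
have -> : cmod (c n) * r ^+ n = cmod (c n * r%:C%C ^+ n).
  by rewrite cmodM cmodX cmodC gtr0_norm.
apply/ler_addgt0Pr => e e0.
have [C C0 CP] := entire_tail cHr ltr01.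
have [|m0 m0P] := @geometric_small R C (1 / 2) e _ e0; first by lra.
pose m := maxn m0 n.+1.
have := @coef_le_circle_sup R (\poly_(i < m) (c i * r%:C%C ^+ i)) (B + e) n.
rewrite coef_poly leq_maxr; apply => w w1.
rewrite horner_poly; set S := \sum_(_ < _) _.
have -> : S = H (r%:C%C * w) - (H (r%:C%C * w) - S) by ring.
rewrite (le_trans (ler_cmodB _ _)) // lerD //.
  by rewrite HB // cmodM cmodC gtr0_norm // w1 mulr1.
by rewrite (le_trans (CP m w _)) ?w1 // -exprVn -div1r m0P // leq_maxl.
Qed.

(* The quotient is [sum_n kappa_(n+1) w^n], where [kappa_n] is
   [sum_(k >= n) c_k w0^(k-n)]; it satisfies [c_n = kappa_n - w0 kappa_(n+1)]. *)
Lemma entire_divided_difference (R : realType) (c : nat -> R[i]) H (w0 : R[i]) :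
  entire_series c H ->
  exists k K, entire_series k K /\ forall w, H w - H w0 = (w - w0) * K w.
Proof.
move=> cH.
have [kap [kap0 kapS kapD]] : exists kap : nat -> R[i],
    [/\ kap 0%N = H w0, forall n, c n = kap n - w0 * kap n.+1 & fast_decay kap].
  have [w00|w00] := eqVneq w0 0.
    exists c; split; last exact: entire_series_decay cH.
    - by rewrite w00 (entire_at0 cH).
    - by move=> n; rewrite w00 mul0r subr0.
  exists (fun n => (H w0 - \sum_(k < n) c k * w0 ^+ k) / w0 ^+ n); split.
  - by rewrite big_ord0 subr0 expr0 divr1.
  - move=> n; rewrite big_ord_recr /= exprS.
    by field; rewrite w00 expf_neq0.
  (* As [rho] exceeds [2 * |w0|], the tail has ratio [q] at most 1/2; as it exceeds [r], [q * r] is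
     at most [|w0|], which compensates the division by [w0 ^+ n]. *)
  - move=> r r0; pose rho := r + 2 * cmod w0.
    have cw0 : 0 < cmod w0 by rewrite cmod_gt0.
    have rho0 : 0 < rho by rewrite addr_gt0 // mulr_gt0.
    have [C C0 CP] := entire_series_decay cH rho0.
    exists (2 * C); first by rewrite mulr_ge0.
    move=> n; pose q := cmod w0 / rho.
    have q0 : 0 <= q by rewrite divr_ge0 ?cmod_ge0 // ltW.
    have q2 : q <= 1 / 2.
      by rewrite ler_pdivrMr // /rho; move: r0; lra.
    have q01 : 0 <= q < 1 by rewrite q0 (le_lt_trans q2) //; lra.
    have := @series_tail R _ _ C q n (cH w0) C0 q01.
    have cq k : cmod (c k * w0 ^+ k) <= C * q ^+ k.
      rewrite cmodM cmodX /q expr_div_n mulrA ler_pdivlMr ?exprn_gt0 //.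
      by rewrite mulrAC ler_wpM2r ?exprn_ge0 ?cmod_ge0.
    move=> /(_ (fun k _ => cq k)); set E := H w0 - _ => EP.
    rewrite cmodM cmodV cmodX mulrAC ler_pdivrMr ?exprn_gt0 //.
    have E2 : cmod E <= 2 * C * q ^+ n.
      rewrite (le_trans EP) // ler_pdivrMr ?subr_gt0; last by case/andP: q01.
      rewrite [2 * C]mulrC -!mulrA ler_wpM2l // mulrCA ler_peMr ?exprn_ge0 //.
      by move: q2; lra.
    apply: le_trans (_ : 2 * C * q ^+ n * r ^+ n <= _).
      by rewrite ler_wpM2r ?exprn_ge0 // ltW.
    rewrite -mulrA ler_wpM2l ?mulr_ge0 // -exprMn lerXn2r ?nnegrE ?cmod_ge0 //.
      by rewrite (mulr_ge0 q0) // ltW.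
    rewrite /q mulrAC ler_pdivrMr // ler_pM2l // /rho lerDl.
    by rewrite mulr_ge0 // ltW.
have kD : fast_decay (fun n => kap n.+1).
  move=> r r0; have [C C0 CP] := kapD r r0.
  exists (C / r); first by rewrite divr_ge0 // ltW.
  by move=> n; rewrite ler_pdivlMr // -mulrA -exprSr.
have [K KP] := entire_of_decay kD.
exists (fun n => kap n.+1), K; split=> // w.
(* Summation by parts; the boundary term [kap T * w ^+ T] tends to 0. *)
have part T : (w - w0) * \sum_(n < T) kap n.+1 * w ^+ n =
    \sum_(n < T) c n * w ^+ n - H w0 + kap T * w ^+ T.
  elim: T => [|T IH]; first by rewrite !big_ord0 mulr0 kap0 expr0; ring.
  by rewrite !big_ord_recr /= mulrDr IH kapS exprS; ring.
apply: (@cvg_cmod_unique R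
  (fun T => (w - w0) * \sum_(n < T) kap n.+1 * w ^+ n)); apply/cvg_cmodP => e e0.
  have e2 : 0 < e / 2 by rewrite divr_gt0.
  have /cvg_cmodP/(_ _ e2)[n1 n1P] := cH w.
  have r0 : 0 < 2 * (cmod w + 1) by rewrite mulr_gt0 // ltr_wpDl ?cmod_ge0.
  have [C C0 CP] := kapD _ r0.
  have [|n2 n2P] := @geometric_small R C (1 / 2) _ _ e2; first by lra.
  exists (maxn n1 n2) => n; rewrite geq_max => /andP[/n1P nn1 /n2P nn2].
  rewrite part.
  have -> : \sum_(i < n) c i * w ^+ i - H w0 + kap n * w ^+ n - (H w - H w0) =
     (series (fun k => c k * w ^+ k) n - H w) + kap n * w ^+ n.
    by rewrite /series /= big_mkord; ring.
  rewrite (le_trans (ler_cmodD _ _)) // [e]splitr lerD // (le_trans _ nn2) //.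
  rewrite cmodM cmodX div1r exprVn ler_pdivlMr ?exprn_gt0 //.
  rewrite -mulrA -exprMn (le_trans _ (CP n)) // ler_wpM2l ?cmod_ge0 //.
  rewrite lerXn2r ?nnegrE ?mulr_ge0 ?addr_ge0 ?cmod_ge0 // mulrC ler_pM2l //.
  by rewrite lerDl.
have /cvg_cmodP/(_ (e / (cmod (w - w0) + 1))) [|n0 n0P] := KP w.
  by rewrite divr_gt0 // ltr_wpDl ?cmod_ge0.
exists n0 => n /n0P; rewrite /series /= big_mkord => nP.
rewrite -mulrBr cmodM (le_trans (ler_wpM2l (cmod_ge0 _) nP)) //.
rewrite mulrCA ler_piMr ?ltW // ltr_pdivrMr ?ltr_wpDl ?cmod_ge0 //.
by rewrite mul1r ltrDl.
Qed.

(** * Continuity of entire functions, and functions without zeros in a disc *)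

Lemma nbhs_cmod (R : realType) (w0 : R[i]) (A : set R[i]) :
  nbhs w0 A <-> exists2 d : R, 0 < d & forall w, cmod (w0 - w) < d -> A w.
Proof.
split=> [/nbhs_ballP[[d di]]|[d d0 dA]].
  rewrite /= ltcE /= => /andP[/eqP -> d0] dA; exists d => // w wd; apply: dA.
  by rewrite -ball_normE /= normc_cmod ltcR.
apply/nbhs_ballP; exists d%:C%C => /=; first by rewrite ltcR.
by move=> w; rewrite -ball_normE /= normc_cmod ltcR => /dA.
Qed.

(** The divided difference at [w0] is bounded on the disc of radius [|w0| + 1], which gives a
    Lipschitz estimate at [w0]. *)
Lemma entire_continuous (R : realType) (c : nat -> R[i]) H (w0 : R[i]) :
  entire_series c H -> {for w0, continuous H}.
Proof.
move=> cH; have [k [K [kK HK]]] := entire_divided_difference w0 cH.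
have r0 : 0 < cmod w0 + 1 by rewrite ltr_wpDl ?cmod_ge0.
have [C C0 CP] := entire_bounded kK r0.
move=> A /nbhs_cmod[e e0 eA]; apply/nbhs_cmod.
have C1 : 0 < C + 1 by rewrite ltr_wpDl.
exists (Num.min 1 (e / (C + 1))); first by rewrite lt_min ltr01 divr_gt0.
move=> w; rewrite lt_min => /andP[wd1 wd2]; apply: eA.
rewrite cmod_distC HK cmodM cmod_distC.
have wr : cmod w <= cmod w0 + 1.
  by rewrite -lerBlDl (le_trans (lerB_cmod _ _)) // cmod_distC ltW.
apply: le_lt_trans (_ : cmod (w0 - w) * (C + 1) < _).
  by rewrite ler_wpM2l ?cmod_ge0 // (le_trans (CP w wr)) // lerDl.
by rewrite -ltr_pdivlMr.
Qed.

Lemma cmod_continuous (R : realType) : continuous (@cmod R : R[i] -> R).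
Proof.
move=> w0 A /nbhs_ballP[e /= e0 eA]; apply/nbhs_cmod; exists e => // w we.
apply: eA; rewrite -ball_normE /=; apply: le_lt_trans we.
rewrite ler_norml lerB_cmod andbT lerNl opprB.
by rewrite cmod_distC lerB_cmod.
Qed.

Lemma complex_pair_continuous (R : realType) :
  continuous (fun p : R * R => (p.1 +i* p.2)%C : R[i]).
Proof.
move=> p0 A /nbhs_cmod[e e0 eA]; apply/nbhs_ballP.
have e2 : 0 < e / 2 by rewrite divr_gt0.
exists (e / 2) => //= p; rewrite /ball /= /prod_ball -!ball_normE /= => -[p1 p2].
apply: eA; rewrite (le_lt_trans (ler_cmodReIm _)) // [e]splitr.
exact: ltrD.
Qed.

(** The disc, seen in [R * R] as a closed part of a square, is compact, so [|H|] attains its minimum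
    there. *)
Lemma entire_zero_free_lower_bound (R : realType) (c : nat -> R[i]) H :
  entire_series c H -> (forall w, cmod w <= 1 -> H w != 0) ->
  exists2 d, 0 < d & forall w, cmod w <= 1 -> d <= cmod (H w).
Proof.
move=> cH H0; pose F (p : R * R) := cmod (H (p.1 +i* p.2)%C).
have Fc : continuous F.
  move=> p; apply: (@continuous_comp _ _ _ (fun p => H (p.1 +i* p.2)%C) (@cmod R)).
    apply: (@continuous_comp _ _ _ (fun p => (p.1 +i* p.2)%C) H).
      exact: complex_pair_continuous.
    exact: entire_continuous cH.
  exact: cmod_continuous.
pose A := (`[(-1 : R), 1] `*` `[(-1 : R), 1])%classic `&`
  [set p : R * R | cmod (p.1 +i* p.2)%C <= 1].
have cA : compact A.
  apply: compact_closedI; first by apply: compact_setX; exact: segment_compact.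
  apply: (@closed_comp _ _ (fun p : R * R => cmod (p.1 +i* p.2)%C) [set x | x <= 1]).
    move=> p _; apply: (@continuous_comp _ _ _
      (fun p : R * R => (p.1 +i* p.2)%C : R[i]) (@cmod R)).
      exact: complex_pair_continuous.
    exact: cmod_continuous.
  exact: closed_le.
have AP w : cmod w <= 1 -> A (Re w, Im w).
  case: w => x y w1; split=> //=; split=> /=; rewrite in_itv /= -ler_norml.
    exact: le_trans (ler_normRe (x +i* y)%C) w1.
  exact: le_trans (ler_normIm (x +i* y)%C) w1.
have A0 : A !=set0 by exists (0, 0); apply: (AP 0); rewrite cmod0.
have [p pA pP] := compact_EVT_min A0 cA (continuous_subspaceT Fc).
exists (F p); first by rewrite cmod_gt0 H0 //; move: pA; rewrite inE => -[].
by case=> x y w1; apply: (pP (x, y)); rewrite inE; exact: AP w1.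
Qed.

(* The Taylor polynomials of [H] have no zeros in the closed unit disc from some
   degree on, so the polynomial case applies to them. *)
Lemma entire_zero_free_coef_bound (R : realType) (c : nat -> R[i]) H (r B L : R) n :
  entire_series c H -> c 0%N = 1 -> 0 < r ->
  (forall w, cmod w <= r -> H w != 0) ->
  (forall w, cmod w = r -> cmod (H w) <= B) -> B < expR L ->
  cmod (c n) * r ^+ n <= (1 + 2 * L) ^+ n.
Proof.
move=> cH c0 r0 H0 HB BL; have cHr := @entire_scale R c H r cH.
have cr w : cmod (r%:C%C * w) = r * cmod w by rewrite cmodM cmodC gtr0_norm.
have -> : cmod (c n) * r ^+ n = cmod (c n * r%:C%C ^+ n).
  by rewrite cmodM cmodX cmodC gtr0_norm.
have [|d d0 dP] := entire_zero_free_lower_bound cHr.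
  by move=> w w1; rewrite H0 // cr ler_piMr // ltW.
have [C C0 CP] := entire_tail cHr ltr01.
(* An error of [d / 2] leaves the Taylor polynomial nonzero; an error of [expR L - B] keeps its
   modulus on the circle at most [expR L]. *)
pose e := Num.min (d / 2) (expR L - B).
have e0 : 0 < e by rewrite lt_min divr_gt0 // subr_gt0.
have [|m0 m0P] := @geometric_small R C (1 / 2) e _ e0; first by lra.
pose m := maxn m0 n.+1; pose a i := c i * r%:C%C ^+ i.
pose p := \poly_(i < m) a i.
have pE w : cmod w <= 1 -> cmod (H (r%:C%C * w) - p.[w]) <= e.
  move=> w1; rewrite horner_poly (le_trans (CP m w w1)) //.
  by rewrite -exprVn -div1r m0P // leq_maxl.
have p_neq0 w : cmod w <= 1 -> p.[w] != 0.
  move=> w1; apply/eqP => pw; have := pE w w1; rewrite pw subr0 => /(le_trans (dP w w1)).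
  by rewrite leNgt gt_min; move: d0; lra.
have pn : p`_n = a n by rewrite coef_poly leq_maxr.
have p0 : p.[0] = 1.
  by rewrite horner_coef0 coef_poly leq_max orbT /a c0 expr0 mulr1.
have [rs pfact] := closed_field_poly_normal p.
have rs1 z : z \in rs -> 1 < cmod z.
  move=> zrs; rewrite ltNge; apply/negP => /p_neq0/eqP; apply.
  by rewrite pfact hornerZ horner_prod (big_rem z zrs) /= hornerXsubC subrr mul0r mulr0.
(* Each ['X - z] is [- z] times [1 - 'X / z], and the scalars collect to [p.[0] = 1]. *)
have pprod : p = \prod_(b <- [seq z^-1 | z <- rs]) (1 - b *: 'X).
  have rs0 z : z \in rs -> z != 0.
    by move=> /rs1 z1; rewrite -cmod_gt0 (lt_trans _ z1).
  have fE : \prod_(z <- rs) ('X - z%:P) =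
      (\prod_(z <- rs) (- z)) *: \prod_(b <- [seq z^-1 | z <- rs]) (1 - b *: 'X).
    rewrite big_map; elim: (rs) rs0 => [|z s IH] s0.
      by rewrite !big_nil scale1r.
    rewrite !big_cons IH => [|y ys]; last by rewrite s0 // inE ys orbT.
    rewrite -scalerAr [- z * _]mulrC -scalerA; congr (_ *: _).
    rewrite scalerAl; congr (_ * _); rewrite scalerBr scalerA mulNr.
    rewrite mulfV ?s0 ?mem_head // scaleN1r opprK addrC; congr (_ + _).
    by rewrite scaleNr alg_polyC.
  rewrite pfact fE scalerA; set x := _ * _.
  suff -> : x = 1 by rewrite scale1r.
  have := p0; rewrite pfact fE scalerA -/x hornerZ horner_prod big1_seq ?mulr1 //.
  by move=> b _; rewrite !hornerE ?mulr0 ?subr0.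
have := @coef_bound_zero_free_prod R [seq z^-1 | z <- rs] L n.
rewrite -pprod pn; apply => [b /mapP[z /rs1 z1 ->]|w w1].
  have z0 : 0 < cmod z by rewrite (lt_trans ltr01 z1).
  by rewrite cmodV invf_lt1.
have -> : \prod_(b <- [seq z^-1 | z <- rs]) (1 - b * w) = p.[w].
  by rewrite pprod horner_prod; apply: eq_bigr => b _; rewrite !hornerE.
have -> : p.[w] = H (r%:C%C * w) - (H (r%:C%C * w) - p.[w]) by ring.
rewrite (le_trans (ler_cmodB _ _)) //.
have := pE w; rewrite w1 lexx le_min => /(_ isT)/andP[_].
have := HB (r%:C%C * w); rewrite cr w1 mulr1 => /(_ erefl).
lra.
Qed.

(** * Dividing out zeros *)

Lemma entire_divide_zero (R : realType) (c : nat -> R[i]) G (z : R[i]) :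
  entire_series c G -> z != 0 -> G z = 0 ->
  exists h H, entire_series h H /\ forall w, G w = (1 - w / z) * H w.
Proof.
move=> cG z0 Gz; have [k [K [kK GK]]] := entire_divided_difference z cG.
exists (fun n => - z * k n), (fun w => - z * K w); split=> [|w].
  exact: entire_seriesZ.
by have := GK w; rewrite Gz subr0 => ->; field.
Qed.

(** On the circle of radius [4 * r] each factor has modulus at least [4 - 1], hence at least 2, so
    every zero divided out gains a factor 2 in Cauchy's estimate. At [n = 0] this counts zeros, in
    place of Jensen's formula. Indexing by [I] allows repeated zeros. *)
Lemma quotient_coef_bound (R : realType) (I : eqType) (z : I -> R[i]) (s : seq I)
    (h : nat -> R[i]) G H (r B : R) n :
  entire_series h H -> (forall w, G w = \prod_(k <- s) (1 - w / z k) * H w) ->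
  0 < r -> (forall k, k \in s -> z k != 0 /\ cmod (z k) <= r) ->
  (forall w, cmod w = 4 * r -> cmod (G w) <= B) ->
  cmod (h n) * (4 * r) ^+ n * 2 ^+ size s <= B.
Proof.
move=> hH GH r0 zP GB; rewrite -ler_pdivlMr ?exprn_gt0 //.
apply: (entire_coef_bound _ hH); first by rewrite mulr_gt0.
move=> w w4; rewrite ler_pdivlMr ?exprn_gt0 // mulrC.
apply: le_trans (GB w w4); rewrite GH cmodM ler_wpM2r ?cmod_ge0 //.
rewrite cmod_prod; elim: s zP {GH} => [|k s IH] zP; first by rewrite big_nil.
rewrite big_cons exprS ler_pM ?exprn_ge0 //; last first.
  by apply: IH => j js; apply: zP; rewrite inE js orbT.
have [zk0 zkr] := zP k (mem_head _ _).
rewrite cmod_distC (le_trans _ (lerB_cmod _ _)) // cmod1 cmodM cmodV w4.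
rewrite lerBrDr ler_pdivlMr ?cmod_gt0 //.
have := cmod_ge0 (z k); lra.
Qed.

(** * Multiplicities and listings of zeros *)

(** Otherwise [z] could be divided out [j] times for every [j]; the quotients take the value 1 at 0,
    so the previous bound would give [2 ^+ j <= B] for all [j]. *)
Lemma entire_multiplicity (R : realType) (c : nat -> R[i]) G (z : R[i]) :
  entire_series c G -> c 0%N = 1 -> z != 0 ->
  exists j h H, [/\ entire_series h H, forall w, G w = (1 - w / z) ^+ j * H w &
    H z != 0].
Proof.
move=> cG c0 z0; apply: contrapT => noj.
have div j : exists h H, entire_series h H /\ forall w, G w = (1 - w / z) ^+ j * H w.
  elim: j => [|j [h [H [hH GH]]]].
    by exists c, G; split=> // w; rewrite expr0 mul1r.
  have [Hz|Hz] := eqVneq (H z) 0; last by case: noj; exists j, h, H.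
  have [h' [H' [hH' HH']]] := entire_divide_zero hH z0 Hz.
  by exists h', H'; split=> // w; rewrite GH HH' exprSr mulrA.
have cz : 0 < cmod z by rewrite cmod_gt0.
have cz4 : 0 < 4 * cmod z by rewrite mulr_gt0.
have [B B0 BP] := entire_bounded cG cz4.
have [||j /(_ j (leqnn j)) jP] := @geometric_small R B (1 / 2) (1 / 2); [lra|lra|].
have [h [H [hH GH]]] := div j.
have h0 : h 0%N = 1.
  have := GH 0; rewrite mul0r subr0 expr1n mul1r (entire_at0 cG) (entire_at0 hH).
  by rewrite c0.
have := @quotient_coef_bound R nat (fun=> z) (iota 0 j) h G H (cmod z) B 0 hH.
rewrite h0 cmod1 mul1r expr0 mul1r size_iota => bound.
have : 2 ^+ j <= B.
  apply: bound => // w; last by move=> w4; rewrite BP // w4.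
  by rewrite GH big_const_seq count_predT size_iota -Monoid.iteropE.
move: jP; rewrite div1r exprVn ler_pdivrMr ?exprn_gt0 // => jP.
have : 0 < 2 ^+ j :> R by rewrite exprn_gt0.
move: jP; lra.
Qed.

(** A factor vanishing at [w0] is [- w0^-1] times [w - w0]; these constants, the other factors and
    [H] make up the continuous nonvanishing cofactor. *)
Lemma zero_mult_prod (R : realType) (phi : nat -> R[i]) (s : seq nat) G h H
    (w0 : R[i]) j :
  entire_series h H ->
  (forall w, G w = \prod_(k <- s) (1 - w / phi k) * ((1 - w / w0) ^+ j * H w)) ->
  H w0 != 0 -> w0 != 0 -> (forall k, k \in s -> phi k != 0) ->
  zero_mult G w0 (count (fun k => phi k == w0) s + j).
Proof.
move=> hH GH Hw0 w00 phi0; pose m := count (fun k => phi k == w0) s.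
pose P w := \prod_(k <- s | phi k != w0) (1 - w / phi k).
exists (fun w => (- w0^-1) ^+ (m + j) * P w * H w); split; last split.
- have mulC (f g : R[i] -> R[i]) : {for w0, continuous f} ->
      {for w0, continuous g} -> {for w0, continuous (fun w => f w * g w)}.
    by move=> fc gc; exact: (continuousM fc gc).
  have cstC (x : R[i]) : {for w0, continuous (fun=> x)} by exact: cst_continuous.
  apply: (mulC (fun w => (- w0^-1) ^+ (m + j) * P w) H); last first.
    exact: entire_continuous hH.
  apply: (mulC (fun=> (- w0^-1) ^+ (m + j)) P); first exact: cstC.
  pose Q t w := \prod_(k <- t | phi k != w0) (1 - w / phi k).
  rewrite -[P]/(Q s); elim: (s) => [|k t IH].
    have -> : Q [::] = (fun=> 1) by apply/funext => w; rewrite /Q big_nil.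
    exact: cstC.
  have [->//|->] : Q (k :: t) = Q t \/ Q (k :: t) = fun w => (1 - w / phi k) * Q t w.
    have [kw|kw] := eqVneq (phi k) w0; [left|right]; apply/funext => w;
      by rewrite /Q big_cons kw ?eqxx.
  apply: (mulC (fun w => 1 - w / phi k) _ _ IH) => A /nbhs_cmod[e e0 eA]; apply/nbhs_cmod.
  have n0 : 0 < cmod (phi k)^-1 + 1 by rewrite ltr_wpDl ?cmod_ge0.
  exists (e / (cmod (phi k)^-1 + 1)); first by rewrite divr_gt0.
  move=> w; rewrite ltr_pdivlMr // => we; apply: eA; apply: le_lt_trans we.
  have -> : 1 - w0 / phi k - (1 - w / phi k) = - ((w0 - w) / phi k) by ring.
  by rewrite cmodN cmodM ler_wpM2l ?cmod_ge0 // lerDl.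
- rewrite !mulf_neq0 ?expf_neq0 ?oppr_eq0 ?invr_eq0 //.
  rewrite /P prodf_seq_neq0; apply/allP => k ks; apply/implyP => kw0.
  rewrite subr_eq0; apply: contra kw0 => /eqP kw0.
  by rewrite -[phi k]mul1r kw0 divfK ?phi0.
- move=> w; rewrite GH (bigID (fun k => phi k == w0)) /= -/(P w).
  have -> : \prod_(k <- s | phi k == w0) (1 - w / phi k) = (1 - w / w0) ^+ m.
    rewrite (eq_bigr (fun=> 1 - w / w0)) => [|k /eqP -> //].
    by rewrite big_const_seq -Monoid.iteropE.
  have -> : 1 - w / w0 = - w0^-1 * (w - w0) by field.
  by rewrite !exprMn !exprD; ring.
Qed.

Lemma card_eq_II_seq (A : set nat) m : (A #= `I_m)%card ->
  exists e : seq nat, [/\ uniq e, size e = m & forall k, k \in e <-> A k].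
Proof.
move=> Am; have fA : finite_set A by apply/finite_setP; exists m.
exists (finmap.enum_fset (fset_set A)); split; [exact: finmap.fset_uniq|exact: card_fset_set|].
by move=> k; rewrite in_fset_set // inE.
Qed.

(** As [G 0 = 1], the point 0 has multiplicity 0 and no index can list it. *)
Lemma listing_neq0 (R : realType) (c : nat -> R[i]) G N phi k :
  entire_series c G -> c 0%N = 1 -> zeros_listing G N phi ->
  idx N k -> phi k != 0.
Proof.
move=> cG c0 list Nk; apply/eqP => phik.
have G0 : G 0 = 1 by rewrite (entire_at0 cG).
have zm : zero_mult G 0 0.
  exists G; split; first exact: entire_continuous cG.
  by split=> [|w]; rewrite ?G0 ?oner_neq0 // expr0 mul1r.
have [e [_ /size0nil -> eP]] := card_eq_II_seq (list _ _ zm).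
by have /eP : idx N k /\ phi k = 0 by [].
Qed.

(** If the quotient by the factors of [s] did not vanish at [phi k], the multiplicity of [phi k]
    would be the number of indices of [s] listing it, yet [k] is one more. *)
Lemma listing_quotient (R : realType) (c : nat -> R[i]) G N phi (s : seq nat) :
  entire_series c G -> c 0%N = 1 -> zeros_listing G N phi ->
  uniq s -> (forall k, k \in s -> idx N k) ->
  exists h H, [/\ entire_series h H, h 0%N = 1 &
    forall w, G w = \prod_(k <- s) (1 - w / phi k) * H w].
Proof.
move=> cG c0 list; elim: s => [|k s IH] /=.
  by move=> _ _; exists c, G; split=> // w; rewrite big_nil mul1r.
move=> /andP[ks us] sN.
have sN' i : i \in s -> idx N i by move=> si; rewrite sN // inE si orbT.
have Nk : idx N k by rewrite sN ?mem_head.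
have phi0 i : idx N i -> phi i != 0 by exact: listing_neq0 cG c0 list.
have [h [H [hH h0 GH]]] := IH us sN'.
suff Hk : H (phi k) = 0.
  have [h' [H' [hH' HH']]] := entire_divide_zero hH (phi0 _ Nk) Hk.
  exists h', H'; split=> // [|w]; last by rewrite big_cons GH HH'; ring.
  have := HH' 0; rewrite mul0r subr0 mul1r (entire_at0 hH) (entire_at0 hH').
  by rewrite h0.
apply/eqP/negPn/negP => Hk.
have := @zero_mult_prod R phi s G h H (phi k) 0 hH.
move=> /(_ _ Hk (phi0 _ Nk) (fun i si => phi0 i (sN' i si))).
rewrite addn0 => /(_ _)/list/card_eq_II_seq[|e [ue se eP]].
  by move=> w; rewrite expr0 mul1r.
have : (size (k :: [seq i <- s | phi i == phi k]) <= size e)%N.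
  apply: uniq_leq_size => [|i].
    by rewrite /= mem_filter (negbTE ks) andbF filter_uniq.
  rewrite inE mem_filter => /predU1P[->|/andP[/eqP ik /sN' Ni]]; exact/eP.
by rewrite /= size_filter se ltnn.
Qed.

Lemma exists_max_seq (T : eqType) (P : seq T -> Prop) (n : nat) :
  P [::] -> (forall s, P s -> (size s <= n)%N) ->
  exists2 s, P s & forall t, P t -> (size t <= size s)%N.
Proof.
move=> P0 Pn; pose Q k := `[< exists2 s, P s & size s = k >].
have Q0 : exists k, Q k by exists 0%N; apply/asboolP; exists [::].
have Qn k : Q k -> (k <= n)%N by move=> /asboolP[s /Pn + <-].
have [k /asboolP[s Ps sk] kmax] := ex_maxnP Q0 Qn.
by exists s => // t Pt; rewrite sk; apply: kmax; apply/asboolP; exists t.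
Qed.

(** Duplicate-free sequences of such indices satisfy [2 ^+ size s <= B], so one of maximal length
    exists, and it contains every such index. *)
Lemma listing_finite (R : realType) (c : nat -> R[i]) G N phi (r : R) :
  entire_series c G -> c 0%N = 1 -> zeros_listing G N phi -> 0 < r ->
  exists2 s : seq nat, uniq s & forall k, k \in s <-> idx N k /\ cmod (phi k) <= r.
Proof.
move=> cG c0 list r0.
have r40 : 0 < 4 * r by rewrite mulr_gt0.
have [B B0 BP] := entire_bounded cG r40.
pose P s := uniq s /\ forall k, k \in s -> idx N k /\ cmod (phi k) <= r.
have sB s : P s -> 2 ^+ size s <= B.
  move=> [us sP].
  have [h [H [hH h0 GH]]] := listing_quotient cG c0 list us (fun k ks => (sP k ks).1).
  have := @quotient_coef_bound R nat phi s h G H r B 0 hH GH r0.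
  rewrite h0 cmod1 mul1r expr0 mul1r; apply.
    move=> k /sP[Nk kr]; split=> //; exact: listing_neq0 cG c0 list Nk.
  by move=> w w4; rewrite BP // w4.
have [||n nP] := @geometric_small R B (1 / 2) (1 / 2); [lra|lra|].
have sn s : P s -> (size s <= n)%N.
  move=> /sB sB'; rewrite leqNgt; apply/negP => /ltnW/nP.
  rewrite div1r exprVn ler_pdivrMr ?exprn_gt0 //.
  have : 0 < 2 ^+ size s :> R by rewrite exprn_gt0.
  move: sB'; lra.
have [|s [us sP] smax] := exists_max_seq _ sn; first by split.
exists s => // k; split=> [/sP//|kP]; apply/negPn/negP => ks.
have /smax : P (k :: s).
  split; first by rewrite /= ks.
  by move=> i; rewrite inE => /predU1P[->|/sP].
by rewrite ltnn.
Qed.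

(** A zero of [H] in the disc would have in [G] a multiplicity above the number of indices of [s]
    listing it, although [s] contains all of them. *)
Lemma listing_zero_free (R : realType) (c : nat -> R[i]) G N phi (r : R)
    (s : seq nat) h H :
  entire_series c G -> c 0%N = 1 -> zeros_listing G N phi ->
  uniq s -> (forall k, k \in s <-> idx N k /\ cmod (phi k) <= r) ->
  entire_series h H -> h 0%N = 1 ->
  (forall w, G w = \prod_(k <- s) (1 - w / phi k) * H w) ->
  forall w, cmod w <= r -> H w != 0.
Proof.
move=> cG c0 list us sP hH h0 GH w wr; apply/eqP => Hw.
have w0 : w != 0.
  by apply/eqP => w0; move: Hw; rewrite w0 (entire_at0 hH) h0; exact/eqP/oner_neq0.
have [j [h' [H' [hH' HH' H'w]]]] := entire_multiplicity hH h0 w0.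
have j0 : (0 < j)%N.
  case: j HH' => // HH'; move: H'w; rewrite -[H' w]mul1r -(expr0 (1 - w / w)).
  by rewrite -HH' Hw eqxx.
have := @zero_mult_prod R phi s G h' H' w j hH' _ H'w w0.
move=> /(_ _ _)/list/card_eq_II_seq[||e [ue se eP]].
- by move=> x; rewrite GH HH'.
- by move=> k /sP[Nk _]; exact: listing_neq0 cG c0 list Nk.
have : (size e <= size [seq i <- s | phi i == w])%N.
  apply: uniq_leq_size => // i /eP[Ni iw].
  by rewrite mem_filter iw eqxx; apply/sP; rewrite iw.
by rewrite size_filter se -[leqRHS]addn0 leq_add2l leqNgt j0.
Qed.

(** * Growth and the zeros *)

(** Growth is used on dyadic circles only: with [b] equal to 2 to the power [l], the exponent
    [l < 1] turns into [b < 2]. *)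
Definition growth_bound (R : realType) (G : R[i] -> R[i]) (A b : R) (j1 : nat) :=
  forall j w, (j1 <= j)%N -> cmod w = 2 ^+ j -> cmod (G w) <= expR (A * b ^+ j).

(** Logarithm of the zero count at [n = 0]; [b ^+ 2] appears because the circle of radius
    [4 * 2 ^+ j] has index [j.+2]. *)
Lemma listing_count (R : realType) (c : nat -> R[i]) G N phi (A b : R) j1 j s :
  entire_series c G -> c 0%N = 1 -> zeros_listing G N phi ->
  growth_bound G A b j1 -> (j1 <= j)%N -> uniq s ->
  (forall k, k \in s -> idx N k /\ cmod (phi k) <= 2 ^+ j) ->
  (size s)%:R <= A * b ^+ 2 / ln 2 * b ^+ j.
Proof.
move=> cG c0 list gG jj us sP.
have [h [H [hH h0 GH]]] := listing_quotient cG c0 list us (fun k ks => (sP k ks).1).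
have r0 : 0 < 2 ^+ j :> R by rewrite exprn_gt0.
have := @quotient_coef_bound R nat phi s h G H _ (expR (A * b ^+ j.+2)) 0 hH GH r0.
rewrite h0 cmod1 mul1r expr0 mul1r => bound.
have ln2 : 0 < ln 2 :> R by rewrite ln_gt0 // ltr1n.
have : 2 ^+ size s <= expR (A * b ^+ j.+2).
  apply: bound => [k /sP[Nk kr]|w w4].
    by split=> //; exact: listing_neq0 cG c0 list Nk.
  by apply: gG; rewrite ?(leqW (leqW jj)) // w4 !exprS mulrA -natrM.
rewrite -ler_ln ?posrE ?exprn_gt0 ?expR_gt0 // expRK lnXn // -[ln 2 *+ _]mulr_natl.
by move=> le_s; rewrite mulrAC ler_pdivlMr // -mulrA -exprD add2n.
Qed.

Lemma exists_pow2_ge (R : realType) (x : R) : exists n, x <= 2 ^+ n.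
Proof.
have [||n /(_ n (leqnn n))] := @geometric_small R x (1 / 2) 1; [lra|lra|].
by rewrite div1r exprVn ler_pdivrMr ?exprn_gt0 // mul1r; exists n.
Qed.

(** The zeros are cut into dyadic shells. The one between [2 ^+ i] and [2 ^+ i.+1] has [O(b ^+ i)]
    zeros, each contributing at most [2 ^- i]; the third factor [b] comes from counting at the outer
    radius. *)
Lemma listing_sum_inv (R : realType) (c : nat -> R[i]) G N phi (A b : R) j1 j s :
  entire_series c G -> c 0%N = 1 -> zeros_listing G N phi ->
  0 <= A -> 1 <= b < 2 -> growth_bound G A b j1 -> (j1 <= j)%N -> uniq s ->
  (forall k, k \in s -> idx N k /\ 2 ^+ j < cmod (phi k)) ->
  \sum_(k <- s) (cmod (phi k))^-1 <=
    A * b ^+ 3 / ln 2 / (1 - b / 2) * (b / 2) ^+ j.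
Proof.
move=> cG c0 list A0 /andP[b1 b2] gG jj us sP.
have b0 : 0 < b by rewrite (lt_le_trans ltr01).
have ln2 : 0 < ln 2 :> R by rewrite ln_gt0 // ltr1n.
have q01 : 0 <= b / 2 < 1.
  by rewrite divr_ge0 ?ltW //= ltr_pdivrMr // mul1r.
pose D := A * b ^+ 3 / ln 2.
have D0 : 0 <= D by rewrite divr_ge0 ?mulr_ge0 ?exprn_ge0 // ltW.
have shell d t : uniq t ->
    (forall k, k \in t -> idx N k /\ 2 ^+ j < cmod (phi k) <= 2 ^+ (j + d)) ->
    \sum_(k <- t) (cmod (phi k))^-1 <= \sum_(j <= i < j + d) D * (b / 2) ^+ i.
  elim: d t => [|d IH] t ut tP.
    rewrite addn0 big_geq // big_seq big1 // => k /tP[_ /andP[k1]].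
    by rewrite addn0 leNgt k1.
  rewrite addnS big_nat_recr ?leq_addr //=.
  rewrite (bigID (fun k => cmod (phi k) <= 2 ^+ (j + d))) /= lerD //.
    rewrite -big_filter IH ?filter_uniq // => k.
    by rewrite mem_filter => /andP[kd /tP[Nk /andP[kj _]]]; rewrite kj.
  rewrite -big_filter; set t' := [seq _ <- t | _].
  apply: le_trans (_ : \sum_(k <- t') (2 ^+ (j + d))^-1 <= _).
    rewrite big_seq [leRHS]big_seq; apply: ler_sum => k.
    rewrite mem_filter -ltNge => /andP[kd _].
    by rewrite lef_pV2 ?posrE ?exprn_gt0 ?(lt_trans _ kd) ?exprn_gt0 // ltW.
  rewrite big_const_seq count_predT iter_addr_0 -[_^-1 *+ _]mulr_natl expr_div_n mulrA.
  rewrite ler_pM2r ?invr_gt0 ?exprn_gt0 //.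
  have -> : D * b ^+ (j + d) = A * b ^+ 2 / ln 2 * b ^+ (j + d).+1.
    by rewrite /D [b ^+ (j + d).+1]exprS; ring.
  apply: (listing_count cG c0 list gG); rewrite ?filter_uniq //.
    by rewrite leqW // (leq_trans jj) // leq_addr.
  by move=> k; rewrite mem_filter -addnS => /andP[_ /tP[Nk /andP[_ ->]]].
have [d dP] : exists d, forall k, k \in s -> cmod (phi k) <= 2 ^+ (j + d).
  have [n nP] := exists_pow2_ge (\sum_(k <- s) cmod (phi k)).
  exists n => k ks; apply: le_trans (_ : 2 ^+ n <= _); last first.
    by rewrite ler_eXn2l ?ltr1n // leq_addl.
  apply: le_trans nP; rewrite (big_rem k) //= lerDl sumr_ge0 // => i _.
  exact: cmod_ge0.
apply: le_trans (shell d s us _) _.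
  by move=> k ks; have [Nk kj] := sP k ks; rewrite kj dP.
by rewrite mulrAC; exact: sum_geometric_le.
Qed.

(** * Convergence of the products over the zeros *)

Lemma cmod_prod_one_sub (R : realType) (I : Type) (s : seq I) (x : I -> R[i]) :
  cmod (\prod_(k <- s) (1 - x k)) <= expR (\sum_(k <- s) cmod (x k)).
Proof.
rewrite cmod_prod expR_sum; apply: ler_prod => k _; rewrite cmod_ge0 /=.
rewrite (le_trans (ler_cmodB _ _)) // cmod1; exact: expR_ge1Dx.
Qed.

Lemma cmod_prod_one_sub_sub1 (R : realType) (I : Type) (s : seq I) (x : I -> R[i]) :
  cmod (\prod_(k <- s) (1 - x k) - 1) <= expR (\sum_(k <- s) cmod (x k)) - 1.
Proof.
elim: s => [|k s IH]; first by rewrite !big_nil subrr cmod0 expR0 subrr.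
rewrite !big_cons expRD; set P := \prod_(_ <- _) _ in IH *.
set E := expR (\sum_(_ <- _) _) in IH *.
have -> : (1 - x k) * P - 1 = (P - 1) - x k * P by ring.
rewrite (le_trans (ler_cmodB _ _)) // cmodM.
have PE : cmod (x k) * cmod P <= cmod (x k) * E.
  by rewrite ler_wpM2l ?cmod_ge0 // cmod_prod_one_sub.
have kE : (1 + cmod (x k)) * E <= expR (cmod (x k)) * E.
  by rewrite ler_wpM2r ?expR_ge0 // expR_ge1Dx.
move: IH PE kE; rewrite mulrDl mul1r; lra.
Qed.

Lemma expR_sub1_le (R : realType) (x : R) : 0 <= x <= 1 / 2 -> expR x - 1 <= 2 * x.
Proof.
move=> /andP[x0 x1].
have := expR_ge1Dx (- x); rewrite expRN.
have e0 : 0 < expR x by rewrite expR_gt0.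
rewrite -(ler_pM2r e0) mulVf ?gt_eqF // => h.
rewrite lerBlDr -(ler_pM2r (_ : 0 < 1 - x)); last by lra.
by rewrite mulrC (le_trans h) //; nra.
Qed.

Lemma entire_horner (R : realType) (p : {poly R[i]}) :
  entire_series (fun n => p`_n) (horner p).
Proof.
move=> w; apply/cvg_cmodP => e e0; exists (size p) => n pn.
rewrite /series /= big_mkord (horner_coef_wide w pn) subrr cmod0; exact: ltW.
Qed.

Lemma entire_seriesB (R : realType) (c d : nat -> R[i]) G H :
  entire_series c G -> entire_series d H ->
  entire_series (fun n => c n - d n) (fun w => G w - H w).
Proof.
move=> cG dH w; apply/cvg_cmodP => e e0.
have e2 : 0 < e / 2 by rewrite divr_gt0.
have /cvg_cmodP/(_ _ e2)[n1 n1P] := cG w.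
have /cvg_cmodP/(_ _ e2)[n2 n2P] := dH w.
exists (maxn n1 n2) => n; rewrite geq_max => /andP[/n1P + /n2P].
rewrite /series /= => nP1 nP2.
under eq_bigr do rewrite mulrBl.
rewrite sumrB; set x := \sum_(_ <= _ < _) _ in nP1 *.
set y := \sum_(_ <= _ < _) _ in nP2 *.
have -> : x - y - (G w - H w) = (x - G w) - (y - H w) by ring.
by rewrite (le_trans (ler_cmodB _ _)) // [e]splitr lerD.
Qed.

(** The zero-free bound gives [|h n| <= y ^+ n] with [y = (1 + 2 * L) / 2 ^+ j]; summed over
    [n >= 1] this is [y / (1 - y)], at most [2 * y]. *)
Lemma quotient_near1 (R : realType) (c h : nat -> R[i]) G H N phi (A b : R) j1 j s w :
  entire_series c G -> c 0%N = 1 -> zeros_listing G N phi ->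
  growth_bound G A b j1 -> (j1 <= j)%N ->
  uniq s -> (forall k, k \in s <-> idx N k /\ cmod (phi k) <= 2 ^+ j) ->
  entire_series h H -> h 0%N = 1 ->
  (forall w, G w = \prod_(k <- s) (1 - w / phi k) * H w) ->
  0 <= A -> 0 <= b -> cmod w = 1 ->
  3 * (1 / 2) ^+ j + 2 * A * b ^+ 2 * (b / 2) ^+ j <= 1 / 2 ->
  cmod (H w - 1) <= 2 * (3 * (1 / 2) ^+ j + 2 * A * b ^+ 2 * (b / 2) ^+ j).
Proof.
move=> cG c0 list gG jj us sP hH h0 GH A0 b0 w1.
have r0 : 0 < 2 ^+ j :> R by rewrite exprn_gt0.
(* The extra 1 absorbs the factor 4/3 of [HB], since 4/3 is below [expR 1]. *)
pose L := A * b ^+ j.+2 + 1.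
set y := _ + _ => y2.
have yE : y = (1 + 2 * L) / 2 ^+ j.
  rewrite /y /L div1r exprVn expr_div_n -[j.+2]add2n [b ^+ (2 + j)]exprD; field.
  by rewrite expf_neq0 ?pnatr_eq0.
pose C := expR (A * b ^+ j.+2).
(* [G] is estimated at radius [4 * 2 ^+ j] but [H] is needed at radius [2 ^+ j]; the ratio 1/4 makes
   the series sum to [4 / 3 * C]. *)
have hC n : cmod (h n) * (2 ^+ j) ^+ n <= C * (1 / 4) ^+ n.
  have := @quotient_coef_bound R nat phi s h G H _ C n hH GH r0.
  rewrite exprMn => bound.
  rewrite div1r exprVn ler_pdivlMr ?exprn_gt0 // -mulrA [_ ^+ n * 4 ^+ n]mulrC.
  apply: le_trans (bound _ _).
  - rewrite ler_peMr ?mulr_ge0 ?exprn_ge0 ?cmod_ge0 //.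
    by rewrite exprn_ege1 // ler1n.
  - by move=> k /sP[Nk kr]; split=> //; exact: listing_neq0 cG c0 list Nk.
  - by move=> x x4; apply: gG; rewrite ?(leqW (leqW jj)) // x4 !exprS mulrA -natrM.
have HB x : cmod x = 2 ^+ j -> cmod (H x) <= 4 / 3 * C.
  move=> xj; have := @series_tail R _ _ C (1 / 4) 0 (hH x).
  rewrite big_ord0 subr0 expr0 mulr1 (_ : C / (1 - 1 / 4) = 4 / 3 * C); last by field.
  apply; [exact: expR_ge0|lra|].
  by move=> k _; rewrite cmodM cmodX xj.
have CL : 4 / 3 * C < expR L.
  rewrite /L expRD -/C mulrC ltr_pM2l ?expR_gt0 //.
  by have := expR_ge1Dx (1 : R); lra.
have hy n : cmod (h n) <= y ^+ n.
  have := entire_zero_free_coef_bound n hH h0 r0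
    (listing_zero_free cG c0 list us sP hH h0 GH) HB CL.
  by rewrite yE expr_div_n -ler_pdivlMr ?exprn_gt0.
have y0 : 0 <= y.
  by rewrite addr_ge0 ?mulr_ge0 ?exprn_ge0 ?divr_ge0.
have := @series_tail R _ _ 1 y 1 (hH w) ler01.
rewrite big_ord_recl big_ord0 /= h0 expr0 mulr1 addr0 expr1 mul1r => tail.
apply: le_trans (tail _ _) _.
- by rewrite y0 (le_lt_trans y2) //; lra.
- by move=> k _; rewrite cmodM cmodX w1 expr1n mulr1 mul1r.
- rewrite ler_pdivrMr; last by move: y2; lra.
  move: y0 y2; nra.
Qed.

(** By Cauchy's estimate it suffices to compare on the unit circle. There the difference is the
    product over [s] times [H] minus the product over the remaining indices [U]: the first factor is
    bounded independently of [j], and both terms of the second are close to 1. *)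
Lemma listing_prod_coef_cvg (R : realType) (c : nat -> R[i]) G N phi (A b : R) j1 n
    (e : R) :
  entire_series c G -> c 0%N = 1 -> zeros_listing G N phi ->
  0 <= A -> 1 <= b < 2 -> growth_bound G A b j1 -> 0 < e ->
  exists M0, forall M, (M0 <= M)%N ->
    cmod (c n - (\prod_(0 <= k < trunc N M) (1 - (phi k)^-1 *: 'X))`_n) <= e.
Proof.
move=> cG c0 list A0 b12 gG e0.
have /andP[b1 b2] := b12; have b0 : 0 <= b by rewrite (le_trans ler01).
have q01 : 0 <= b / 2 < 1 by rewrite divr_ge0 //= ltr_pdivrMr // mul1r.
have r1 : 0 < 2 ^+ j1 :> R by rewrite exprn_gt0.
have [s1 us1 s1P] := listing_finite cG c0 list r1.
pose D := A * b ^+ 3 / ln 2 / (1 - b / 2).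
pose K := \sum_(k <- s1) (cmod (phi k))^-1 + D * (b / 2) ^+ j1.
have K0 : 0 < expR K by rewrite expR_gt0.
(* [H] will be within [4 * d] of 1 and the product over [U] within [2 * d], so 8 suffices. The cap
   1/4 keeps two errors of size [d] below the 1/2 that [quotient_near1] demands. *)
pose d := Num.min (1 / 4) (e / (8 * expR K)).
have d0 : 0 < d by rewrite lt_min divr_gt0 //= divr_gt0 ?mulr_gt0.
have d4 : d <= 1 / 4 by rewrite ge_min lexx.
have dK : expR K * (8 * d) <= e.
  have : d <= e / (8 * expR K) by rewrite ge_min lexx orbT.
  rewrite ler_pdivlMr ?mulr_gt0 //.
  by rewrite [expR K * _]mulrC -mulrA mulrCA.
have [|ja jaP] := @geometric_small R 3 (1 / 2) d _ d0; first by lra.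
have [jb jbP] := @geometric_small R (2 * A * b ^+ 2) (b / 2) d q01 d0.
have [jc jcP] := @geometric_small R D (b / 2) d q01 d0.
pose j := maxn j1 (maxn ja (maxn jb jc)).
have jj1 : (j1 <= j)%N by rewrite leq_maxl.
have {}jaP : 3 * (1 / 2) ^+ j <= d by apply: jaP; rewrite !leq_max leqnn !orbT.
have {}jbP : 2 * A * b ^+ 2 * (b / 2) ^+ j <= d.
  by apply: jbP; rewrite !leq_max leqnn !orbT.
have {}jcP : D * (b / 2) ^+ j <= d by apply: jcP; rewrite !leq_max leqnn !orbT.
have rj : 0 < 2 ^+ j :> R by rewrite exprn_gt0.
have [s us sP] := listing_finite cG c0 list rj.
have [h [H [hH h0 GH]]] :=
  listing_quotient cG c0 list us (fun k ks => ((sP k).1 ks).1).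
(* Past every index of [s], the truncated product contains all the factors of [s]. *)
exists (\max_(k <- s) k).+1 => M MM0; pose T := index_iota 0 (trunc N M).
have TN k : k \in T -> idx N k.
  rewrite mem_index_iota /trunc /idx; case: (N) => [m|] //.
  by rewrite leq_min => /andP[_ /andP[]].
have sT k : k \in s -> k \in T.
  move=> ks; have /sP[Nk _] := ks.
  have kM : (k < M)%N by rewrite (leq_trans _ MM0) // ltnS (leq_bigmax_seq k).
  rewrite mem_index_iota /=; move: Nk; rewrite /trunc /idx.
  by case: (N) => [m|] //; rewrite leq_min kM.
pose U := [seq k <- T | k \notin s].
have splitT w : \prod_(k <- T) (1 - w / phi k) =
    \prod_(k <- s) (1 - w / phi k) * \prod_(k <- U) (1 - w / phi k).
  rewrite (bigID (mem s)) /= big_filter; congr (_ * _).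
  rewrite -big_filter; apply: perm_big; apply: uniq_perm; rewrite ?filter_uniq ?iota_uniq //.
  by move=> k; rewrite mem_filter /=; case: (boolP (k \in s)) => // /sT.
set p := \prod_(0 <= k < _) _.
have pE w : p.[w] = \prod_(k <- T) (1 - w / phi k).
  by rewrite horner_prod; apply: eq_bigr => k _; rewrite !hornerE mulrC.
have := entire_coef_bound n (entire_seriesB cG (@entire_horner R p)) ltr01.
move=> /(_ e); rewrite expr1n mulr1; apply => w w1.
have cw k : cmod (w / phi k) = (cmod (phi k))^-1 by rewrite cmodM cmodV w1 mul1r.
rewrite pE splitT GH -mulrBr cmodM (le_trans _ dK) // ler_pM ?cmod_ge0 //.
  apply: le_trans (cmod_prod_one_sub _ _) _; rewrite ler_expR.
  under eq_bigr do rewrite cw.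
  rewrite (bigID (mem s1)) /= lerD //.
    rewrite -[leLHS]big_filter.
    rewrite (perm_big s1) //; apply: uniq_perm; rewrite ?filter_uniq // => k.
    rewrite mem_filter /=; case: (boolP (k \in s1)) => //= /s1P[Nk k1].
    apply/sP; split=> //; rewrite (le_trans k1) //.
    by rewrite ler_eXn2l ?ltr1n.
  rewrite -[leLHS]big_filter.
  apply: (listing_sum_inv cG c0 list A0 b12 gG (leqnn _)); rewrite ?filter_uniq //.
  move=> k; rewrite mem_filter => /andP[ks1 /sP[Nk _]]; split=> //.
  by rewrite ltNge; apply: contra ks1 => k1; apply/s1P.
have -> : H w - \prod_(k <- U) (1 - w / phi k) =
    (H w - 1) - (\prod_(k <- U) (1 - w / phi k) - 1) by ring.
apply: le_trans (ler_cmodB _ _) _.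
have Hw : cmod (H w - 1) <= 4 * d.
  apply: le_trans (quotient_near1 cG c0 list gG jj1 us sP hH h0 GH A0 b0 w1 _) _.
    by move: jaP jbP d4; lra.
  by move: jaP jbP; lra.
have sU : \sum_(k <- U) cmod (w / phi k) <= d.
  under eq_bigr do rewrite cw.
  apply: le_trans jcP.
  apply: (listing_sum_inv cG c0 list A0 b12 gG jj1); rewrite ?filter_uniq ?iota_uniq //.
  move=> k; rewrite mem_filter => /andP[ks /TN Nk]; split=> //.
  by rewrite ltNge; apply: contra ks => k1; apply/sP.
have sU0 : 0 <= \sum_(k <- U) cmod (w / phi k).
  by apply: sumr_ge0 => k _; exact: cmod_ge0.
have PU : cmod (\prod_(k <- U) (1 - w / phi k) - 1) <= 2 * d.
  apply: le_trans (cmod_prod_one_sub_sub1 _ _) _.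
  apply: le_trans (expR_sub1_le _) _; last by rewrite ler_pM2l.
  by rewrite sU0 (le_trans sU) // (le_trans d4) //; lra.
move: Hw PU d0; lra.
Qed.

(** * Symmetric functions, order of growth, and the coefficient formula *)

Lemma coef_prod_one_sub (R : realType) (phi : nat -> R[i]) n M :
  (\prod_(0 <= k < M) (1 - (phi k)^-1 *: 'X))`_n = (-1) ^+ n * esym_inv phi n M.
Proof.
rewrite big_mkord.
under eq_bigr => k _ do rewrite addrC -scaleNr.
rewrite (bigA_distr _ _ (fun k : 'I_M => - (phi k)^-1 *: 'X) (fun=> 1)) coef_sum.
rewrite /esym_inv mulr_sumr [RHS]big_mkcond /=; apply: eq_bigr => S _.
rewrite -big_mkcond /= scaler_prod prodr_const coefZ coefXn eq_sym.
case: eqP => [<-|_]; last by rewrite mulr0.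
by rewrite mulr1 prodrN prodfV.
Qed.

Lemma zeros_listingZ (R : realType) (g : R[i] -> R[i]) N phi (x : R[i]) :
  x != 0 -> zeros_listing g N phi -> zeros_listing (fun w => x * g w) N phi.
Proof.
move=> x0 list w0 m [h [hc [hw0 gh]]]; apply: list.
exists (fun w => x^-1 * h w); split.
  have xc : {for w0, continuous (fun=> x^-1 : R[i])} by exact: cst_continuous.
  exact: (continuousM xc hc).
split=> [|w]; first by rewrite mulf_neq0 ?invr_eq0.
by rewrite mulrCA -gh mulKf.
Qed.

(** Since the infimum is below 1, some admissible exponent [l] is too, and [b] is 2 to the power
    [l]. The affine change costs a factor [K], absorbed by [K <= expR K] and [K + t <= (1 + K) * t]
    for [t >= 1]. *)
Lemma entire_order_growth (R : realType) (f : R[i] -> R[i]) (rho : R) (x y : R[i]) :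
  entire_order f rho -> rho < 1 ->
  exists A b j1, [/\ 0 <= A, 1 <= b < 2 &
    growth_bound (fun w => x * (f w - y)) A b j1].
Proof.
move=> [ne ->] /(inf_lt ne)[l [l0 [r1 [_ r1P]]] l1].
pose b := (2 : R) `^ l.
have bexp : b = expR (l * ln 2) by rewrite /b /powR pnatr_eq0.
have ln2 : 0 < ln 2 :> R by rewrite ln_gt0 // ltr1n.
have b1 : 1 <= b.
  by rewrite bexp -[leLHS]expR0 ler_expR mulr_ge0 // ltW.
have b2 : b < 2.
  rewrite bexp -[ltRHS]lnK ?posrE // ltr_expR -[ltRHS]mul1r.
  by rewrite ltr_pM2r.
have bE j : (2 ^+ j) `^ l = b ^+ j.
  by rewrite -powR_mulrn // powRAC powR_mulrn // powR_ge0.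
pose K := cmod x * (1 + cmod y).
have K0 : 0 <= K by rewrite mulr_ge0 ?addr_ge0 ?cmod_ge0.
have [j1 j1P] := exists_pow2_ge (r1 + 1).
exists (1 + K), b, j1; split; [by rewrite addr_ge0|by rewrite b1|].
move=> j w jj wj.
have fw : cmod (f w) <= expR (b ^+ j).
  rewrite -bE; apply: (r1P (2 ^+ j)) => //.
  apply: (@lt_le_trans _ _ (r1 + 1)); first by rewrite ltrDl.
  by rewrite (le_trans j1P) // ler_eXn2l // ltr1n.
have bj1 : 1 <= b ^+ j by rewrite exprn_ege1.
set t := b ^+ j in fw bj1 *.
have t1 : 1 <= expR t by rewrite -(expR0 R) ler_expR (le_trans ler01).
rewrite cmodM; apply: (@le_trans _ _ (K * expR t)).
  rewrite /K -mulrA ler_wpM2l ?cmod_ge0 // (le_trans (ler_cmodB _ _)) //.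
  rewrite mulrDl mul1r lerD // ler_peMr ?cmod_ge0 //.
apply: (@le_trans _ _ (expR (K + t))).
  rewrite expRD ler_pM2r ?expR_gt0 //.
  by apply: le_trans (expR_ge1Dx K); rewrite lerDr.
by rewrite ler_expR mulrDl mul1r addrC lerD2l ler_peMr.
Qed.

Unset Implicit Arguments.
Set Strict Implicit.

Theorem theorem17 (R : realType) (a : nat -> R[i]) (f : R[i] -> R[i]) (rho : R)
  (hf : entire_series a f) (hord : entire_order f rho)
  (hrho : 0 <= rho < 1)
  (z : R[i]) (hz : f z != f 0)
  (N : option nat) (phi : nat -> R[i])
  (hphi : zeros_listing (fun w => f w - f z) N phi)
  (n : nat) (hn : (0 < n)%N) :
  exists E : R[i],
    (fun M => esym_inv phi n (trunc N M)) @ \oo --> E /\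
    a n = (-1) ^+ n * (f 0 - f z) * E.
Proof.
pose g0 : R[i] := f 0 - f z.
have g00 : g0 != 0 by rewrite subr_eq0 eq_sym.
have g0V : g0^-1 != 0 by rewrite invr_eq0.
pose c k := g0^-1 * (a k - (f z)%:P`_k).
pose G w := g0^-1 * (f w - f z).
have cG : entire_series c G.
  have := @entire_seriesZ R _ _ g0^-1 (entire_seriesB hf (@entire_horner R (f z)%:P)).
  by congr (entire_series _ _); apply/funext => w; rewrite /G hornerC.
have c0 : c 0%N = 1.
  by rewrite /c coefC eqxx -(entire_at0 hf) mulVf.
(* Subtracting the constant [f z] affects only index 0, which [hn] excludes. *)
have cn : c n = g0^-1 * a n by rewrite /c coefC gtn_eqF // subr0.
have list : zeros_listing G N phi by exact: zeros_listingZ.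
have [A [b [j1 [A0 b12 gG]]]] :=
  entire_order_growth g0^-1 (f z) hord (andP hrho).2.
(* The limit is the value forced by the formula, the sign being its own inverse; what remains is the
   convergence. *)
exists ((-1) ^+ n * (a n / g0)); split; last first.
  by rewrite mulrACA -expr2 sqrr_sign mul1r mulrC divfK.
apply/cvg_cmodP => e e0.
have [M0 M0P] := listing_prod_coef_cvg n cG c0 list A0 b12 gG e0.
exists M0 => M /M0P; rewrite coef_prod_one_sub cn; apply: le_trans.
rewrite [leRHS]cmod_distC.
have -> : (-1) ^+ n * esym_inv phi n (trunc N M) - g0^-1 * a n =
    (-1) ^+ n * (esym_inv phi n (trunc N M) - (-1) ^+ n * (a n / g0)).
  by rewrite mulrBr mulrA -expr2 sqrr_sign mul1r [a n / _]mulrC.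
by rewrite cmodM cmodX cmodN cmod1 expr1n mul1r.
Qed.
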